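(* Let $m\ge1$. (i) For all $1\le i,j\le m+2n$, $J_{ij}\circ\pi^\sharp_{\mathbb{S}^{m-1|2n}}=\pi^\sharp_{\mathbb{S}^{m-1|2n}}\circ L_{ij}$ as maps $\mathcal{O}(\mathbb{R}^{m|2n})\to\mathcal{O}(\mathbb{S}^{m-1|2n})$. (ii) For all $1\le i,j,k,l\le m+2n$, $\langle J_{ij},J_{kl}\rangle_{\mathbb{S}^{m-1|2n}}=\pi^\sharp_{\mathbb{S}^{m-1|2n}}\big(\langle L_{ij},L_{kl}\rangle\big)$, i.e. the metric of $\mathbb{S}^{m-1|2n}$ is the one induced by the embedding $\pi_{\mathbb{S}^{m-1|2n}}$ into $\mathbb{R}^{m|2n}$.
   Context: $\mathbb{R}^{m|2n}$: even $x_1..x_m$, odd $\grave{x}_1..\grave{x}_{2n}$, $(X_1,\dots,X_{m+2n})$ all coordinates, $[i]=0$ if $i\le m$ else $1$; $\partial_{X^i}=\partial_{x_i}$ ($i\le m$), $\partial_{X^{m+2k-1}}=2\partial_{\grave{x}_{2k}}$, $\partial_{X^{m+2k}}=-2\partial_{\grave{x}_{2k-1}}$; $L_{ij}=X_i\partial_{X^j}-(-1)^{[i][j]}X_j\partial_{X^i}$. The metric on $\mathbb{R}^{m|2n}$ is the graded $\mathcal{O}$-bilinear form on vector fields with $\langle f\partial_{X_j}|h\partial_{X^k}\rangle=(-1)^{|h|[j]}\delta_j^k fh$. $r=|\underline x|$, $\theta^2=-\sum_k\grave{x}_{2k-1}\grave{x}_{2k}$, $\phi^\sharp(f)=\sum_{j=0}^n\frac{(-1)^j\theta^{2j}}{j!}(\frac{1}{2r}\partial_r)^jf$.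 The supersphere $\mathbb{S}^{m-1|2n}=(\mathbb{S}^{m-1},\mathcal{C}^\infty_{\mathbb{S}^{m-1}}\otimes\Lambda_{2n})$ with odd generators $\grave{y}_1..\grave{y}_{2n}$, $\theta_y^2=-\sum_k\grave{y}_{2k-1}\grave{y}_{2k}$, coordinate functions $\xi_i$ on $\mathbb{S}^{m-1}$. $\pi^\sharp_{\mathbb{S}^{m-1|2n}}=(\mathrm{res}_{r=1}\otimes\rho)\circ\phi^\sharp$, where $\mathrm{res}_{r=1}$ restricts each coefficient to the unit sphere and $\rho$ sends $\grave{x}_j\mapsto\grave{y}_j$. On $\mathbb{S}^{m-1|2n}$: $\partial_{\grave{y}^{2k-1}}=2\partial_{\grave{y}_{2k}}$, $\partial_{\grave{y}^{2k}}=-2\partial_{\grave{y}_{2k-1}}$, $\grave{y}^{2k-1}=\frac12\grave{y}_{2k}$, $\grave{y}^{2k}=-\frac12\grave{y}_{2k-1}$; $J_{ij}=L_{ij}$ (standard $\mathfrak{o}(m)$ fields on $\mathbb{S}^{m-1}$) for $i,j\le m$; $J_{ij}=\grave{y}_{i-m}\partial_{\grave{y}^{j-m}}+\grave{y}_{j-m}\partial_{\grave{y}^{i-m}}$ for $i,j>m$; $J_{ij}=\xi_i\sqrt{1-\theta^2_y}\partial_{\grave{y}^{j-m}}-\frac{\grave{y}_{j-m}}{\sqrt{1-\theta_y^2}}\sum_{l=1}^m\xi_lL_{li}$ for $i\le m<j$ (and $J_{ji}=-(-1)^{[i][j]}J_{ij}$). The metric on $\mathbb{S}^{m-1|2n}$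 is the graded $\mathcal{O}$-bilinear form with $\langle L_{ij},L_{kl}\rangle_{\mathbb{S}^{m-1|2n}}=(1-\theta^2_y)\langle L_{ij},L_{kl}\rangle_{\mathbb{S}^{m-1}}$ (round metric) for $i,j,k,l\le m$, $\langle L_{ij},\partial_{\grave{y}_l}\rangle=0$, $\langle\partial_{\grave{y}_k},\partial_{\grave{y}_l}\rangle=J^{lk}+\frac{\grave{y}^k\grave{y}^l}{1-\theta_y^2}$, where $J^{lk}$ are the entries of $J=\frac12\mathrm{diag}\big(\begin{smallmatrix}0&-1\\1&0\end{smallmatrix},\dots\big)$. *)

(* Defs.v *)
From HB Require Import structures.
From Stdlib Require Import Reals ClassicalEpsilon Factorial.
From mathcomp Require Import ssreflect ssrfun ssrbool eqtype ssrnat seq choice fintype finset bigop.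


Open Scope R_scope.

(* A point of R^m is x : nat -> R, with x k (k < m) the coordinate x_{k+1}. *)
Definition Pt := nat -> R.
Definition upd (x : Pt) (k : nat) (t : R) : Pt := fun i => if i == k then t else x i.
(* the derivative of g at t0 (when it exists; it is then unique) *)
Definition dlim (g : R -> R) (t0 : R) : R :=
  epsilon (inhabits 0) (fun l => derivable_pt_lim g t0 l).
Definition pd (k : nat) (f : Pt -> R) : Pt -> R :=
  fun x => dlim (fun t => f (upd x k t)) (x k).
Fixpoint ipd (ks : seq nat) (f : Pt -> R) : Pt -> R :=
  match ks with [::] => f | k :: ks' => pd k (ipd ks' f) end.
Definition rsum (m : nat) (g : nat -> R) : R := \big[Rplus/0]_(k < m) g k.

Definition tail_indep (m : nat) (f : Pt -> R) : Prop :=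
  forall x y : Pt, (forall k, (k < m)%N -> x k = y k) -> f x = f y.
Definition contm (m : nat) (g : Pt -> R) : Prop :=
  forall (x : Pt) (eps : R), 0 < eps -> exists delta, 0 < delta /\
    forall y : Pt, (forall k, (k < m)%N -> Rabs (y k - x k) < delta) -> Rabs (g y - g x) < eps.
Definition Cinf (m : nat) (f : Pt -> R) : Prop :=
  tail_indep m f /\
  forall ks : seq nat, all (fun k => (k < m)%N) ks ->
    contm m (ipd ks f) /\
    forall (k : nat) (x : Pt), (k < m)%N ->
      exists l, derivable_pt_lim (fun t => ipd ks f (upd x k t)) (x k) l.

(* Odd generators are indexed 0..2n-1 (0-based: generator a is x`_{a+1}).
   A superfunction is the family of coefficients of the monomials
   x`_A = x`_{a1} ... x`_{ak} (a1 < ... < ak), A a subset of 'I_(2n). *)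
Definition Mon (n : nat) := {set 'I_(2 * n)%N}.
Definition SF (n : nat) := Mon n -> Pt -> R.

Definition sf_zero n : SF n := fun _ _ => 0.
Definition sf_add {n} (F G : SF n) : SF n := fun S x => F S x + G S x.
Definition sf_opp {n} (F : SF n) : SF n := fun S x => - F S x.
Definition sf_scal {n} (c : R) (F : SF n) : SF n := fun S x => c * F S x.
Definition sf_ev n (f : Pt -> R) : SF n := fun S x => if S == set0 then f x else 0.
Definition sf_const n (c : R) : SF n := sf_ev n (fun _ => c).
Definition oddset n (a : nat) : Mon n := [set i : 'I_(2 * n)%N | nat_of_ord i == a].
Definition sf_gen n (a : nat) : SF n :=
  fun S _ => if (a < 2 * n)%N && (S == oddset n a) then 1 else 0.
(* number of inversions needed to sort x`_A x`_B *)
Definition ninv {n} (A B : Mon n) : nat := (\sum_(a in A) #|[set b in B | (b < a)%N]|)%N.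
Definition sf_mul {n} (F G : SF n) : SF n :=
  fun S x => \big[Rplus/0]_(A in powerset S)
               ((-1) ^ (ninv A (S :\: A)) * F A x * G (S :\: A) x).
Fixpoint sf_pow {n} (F : SF n) (k : nat) : SF n :=
  match k with O => sf_const n 1 | S k' => sf_mul F (sf_pow F k') end.
Definition sf_inv {n} (F : SF n) : SF n := fun S x => if odd #|S| then - F S x else F S x.
(* left derivative with respect to the odd generator with 0-based index a *)
Definition sf_dodd {n} (a : nat) (F : SF n) : SF n :=
  fun S x => if (a < 2 * n)%N && (S :&: oddset n a == set0)
             then (-1) ^ #|[set i in S | (i < a)%N]| * F (S :|: oddset n a) x else 0.
Definition sf_dev {n} (k : nat) (F : SF n) : SF n := fun S => pd k (F S).
Definition sf_sum {n} (k0 k1 : nat) (G : nat -> SF n) : SF n :=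
  \big[@sf_add n/sf_zero n]_(k0 <= k < k1) G k.

(* all indices i, j, k below are 1-based, 1 <= i <= m+2n *)
Definition par (m i : nat) : bool := (m < i)%N.
Definition Xc m n (i : nat) : SF n :=
  if (i <= m)%N then sf_ev n (fun x => x i.-1) else sf_gen n (i - m).-1.
(* d_{X^k}: d_{x_k} (k<=m); d_{X^{m+2p-1}} = 2 d_{x`_{2p}}; d_{X^{m+2p}} = -2 d_{x`_{2p-1}} *)
Definition dUp m n (k : nat) (F : SF n) : SF n :=
  if (k <= m)%N then sf_dev k.-1 F
  else if odd (k - m) then sf_scal 2 (sf_dodd (k - m) F)
  else sf_scal (-2) (sf_dodd (k - m).-2 F).
(* vector fields V = sum_k V k d_{X^k} *)
Definition VFR (n : nat) := nat -> SF n.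
Definition actR m n (V : VFR n) (F : SF n) : SF n :=
  sf_sum 1 (m + 2 * n).+1 (fun k => sf_mul (V k) (dUp m n k F)).
(* L_ij = X_i d_{X^j} - (-1)^{[i][j]} X_j d_{X^i} *)
Definition Lf m n (i j : nat) : VFR n :=
  fun k => sf_add (if k == j then Xc m n i else sf_zero n)
                  (sf_scal (if par m i && par m j then 1 else -1)
                           (if k == i then Xc m n j else sf_zero n)).
(* coefficients of V in the basis d_{X_j} (d_{X_j} = d_{x_j}, resp. d_{x`_{j-m}}):
   d_{X^{m+2p-1}} = 2 d_{X_{m+2p}},  d_{X^{m+2p}} = -2 d_{X_{m+2p-1}} *)
Definition lowR m n (V : VFR n) (j : nat) : SF n :=
  if (j <= m)%N then V j
  else if odd (j - m) then sf_scal (-2) (V j.+1) else sf_scal 2 (V j.-1).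
(* <f d_{X_j} | h d_{X^k}> = (-1)^{|h|[j]} delta_j^k f h, extended additively *)
Definition metR m n (V W : VFR n) : SF n :=
  sf_sum 1 (m + 2 * n).+1
    (fun j => sf_mul (lowR m n V j) (if par m j then sf_inv (W j) else W j)).

Definition r2 (m : nat) (x : Pt) : R := rsum m (fun k => x k ^ 2).
(* (1/(2r)) d_r f = (1/(2 r^2)) sum_k x_k d_{x_k} f *)
Definition Erad (m : nat) (f : Pt -> R) : Pt -> R :=
  fun x => / (2 * r2 m x) * rsum m (fun k => x k * pd k f x).
Definition theta2 n : SF n :=
  sf_opp (\big[@sf_add n/sf_zero n]_(p < n)
            sf_mul (sf_gen n (2 * p)%N) (sf_gen n (2 * p).+1)).
Definition phi m n (F : SF n) : SF n :=
  \big[@sf_add n/sf_zero n]_(j < n.+1)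
     sf_scal ((-1) ^ j / INR (Factorial.fact j))
             (sf_mul (sf_pow (theta2 n) j) (fun S => iter j (Erad m) (F S))).
(* O(S^{m-1|2n}) = C^oo(S^{m-1}) (x) Lambda_{2n} is represented by the same
   type SF n, where only the values at points of the unit sphere matter
   (equalities are asserted only at points x with onS m x).  The odd generators
   y`_a are represented by the same generators (rho is the identity on the
   representation), and res_{r=1} is evaluation at sphere points only. *)
Definition onS (m : nat) (x : Pt) : Prop := r2 m x = 1.
Definition piS m n (F : SF n) : SF n := phi m n F.

(* flow of L_ij = x_i d_j - x_j d_i (0-based i j) *)
Definition rot (i j : nat) (t : R) (x : Pt) : Pt :=
  fun k => if i == j then x k
           else if k == i then cos t * x i - sin t * x j
           else if k == j then cos t * x j + sin t * x i
           else x k.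
(* the standard o(m) vector field L_ij on S^{m-1} (1-based i j) acting on a
   function on the sphere: derivative along the rotation flow *)
Definition LS (i j : nat) (g : Pt -> R) : Pt -> R :=
  fun x => dlim (fun t => g (rot i.-1 j.-1 t x)) 0.
(* vector fields on S^{m-1|2n}: V = sum_{i,j<=m} V.1 i j L_ij + sum_a V.2 a d_{y`_a} *)
Definition VFS (n : nat) := ((nat -> nat -> SF n) * (nat -> SF n))%type.
Definition actS m n (V : VFS n) (G : SF n) : SF n :=
  sf_add (sf_sum 1 m.+1 (fun i => sf_sum 1 m.+1 (fun j =>
             sf_mul (V.1 i j) (fun S => LS i j (G S)))))
         (sf_sum 1 (2 * n).+1 (fun a => sf_mul (V.2 a) (sf_dodd a.-1 G))).

Definition xi n (i : nat) : SF n := sf_ev n (fun x => x i.-1).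
Definition ygen n (a : nat) : SF n := sf_gen n a.-1.
Definition gbinom (a : R) (k : nat) : R :=
  (\big[Rmult/1]_(i < k) (a - INR i)) / INR (Factorial.fact k).
(* sum_{k<=n} c_k (theta_y^2)^k; theta^{2(n+1)} = 0, so this is the Taylor
   series of the corresponding function of theta^2 *)
Definition tser n (c : nat -> R) : SF n :=
  \big[@sf_add n/sf_zero n]_(k < n.+1) sf_scal (c k) (sf_pow (theta2 n) k).
Definition sq n : SF n := tser n (fun k => gbinom (1/2) k * (-1) ^ k).     (* sqrt(1-theta^2) *)
Definition isq n : SF n := tser n (fun k => gbinom (-1/2) k * (-1) ^ k).   (* 1/sqrt(1-theta^2) *)
Definition i1m n : SF n := tser n (fun _ => 1).                             (* 1/(1-theta^2) *)
(* d_{y`^b} = sum_a dyUpc b a d_{y`_a}: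
   d_{y`^{2p-1}} = 2 d_{y`_{2p}}, d_{y`^{2p}} = -2 d_{y`_{2p-1}} *)
Definition dyUpc (b a : nat) : R :=
  if odd b then (if a == b.+1 then 2 else 0) else (if a == b.-1 then -2 else 0).
Definition yUp n (b : nat) : SF n :=
  if odd b then sf_scal (1/2) (ygen n b.+1) else sf_scal (-1/2) (ygen n b.-1).

Definition vfs_opp {n} (V : VFS n) : VFS n :=
  (fun p q => sf_opp (V.1 p q), fun a => sf_opp (V.2 a)).
Definition Jmixed m n (i j : nat) : VFS n :=
  (fun p q => if q == i then sf_opp (sf_mul (sf_mul (ygen n (j - m)) (isq n)) (xi n p))
              else sf_zero n,
   fun a => sf_scal (dyUpc (j - m) a) (sf_mul (xi n i) (sq n))).
Definition Jf m n (i j : nat) : VFS n :=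
  if (i <= m)%N && (j <= m)%N then
    (fun p q => if (p == i) && (q == j) then sf_const n 1 else sf_zero n,
     fun _ => sf_zero n)
  else if (m < i)%N && (m < j)%N then
    (fun _ _ => sf_zero n,
     fun a => sf_add (sf_scal (dyUpc (j - m) a) (ygen n (i - m)))
                     (sf_scal (dyUpc (i - m) a) (ygen n (j - m))))
  else if (i <= m)%N then Jmixed m n i j
  else vfs_opp (Jmixed m n j i).

(* the matrix J = 1/2 diag([[0,-1],[1,0]], ...): entry J^{lk} (1-based) *)
Definition Jm (l k : nat) : R :=
  if odd l && (k == l.+1) then -1/2 else if ~~ odd l && (k.+1 == l) then 1/2 else 0.
(* <d_{y`_k}, d_{y`_l}> = J^{lk} + y`^k y`^l / (1 - theta^2) *)
Definition gS n (k l : nat) : SF n :=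
  sf_add (sf_const n (Jm l k)) (sf_mul (sf_mul (yUp n k) (yUp n l)) (i1m n)).
Definition kd (a b : nat) : R := if a == b then 1 else 0.
(* round metric <L_ij, L_kl>_{S^{m-1}} at xi (induced from the euclidean metric):
   L_ij = xi_i e_j - xi_j e_i *)
Definition round n (i j k l : nat) : SF n :=
  sf_ev n (fun x => x i.-1 * x k.-1 * kd j l - x i.-1 * x l.-1 * kd j k
                  - x j.-1 * x k.-1 * kd i l + x j.-1 * x l.-1 * kd i k).
(* graded O-bilinear metric on S^{m-1|2n}:
   <f L_ij + ... | h L_kl + ...> with <fV|hW> = (-1)^{|h||V|} f h <V|W> *)
Definition metS m n (V W : VFS n) : SF n :=
  sf_add
    (sf_sum 1 m.+1 (fun i => sf_sum 1 m.+1 (fun j => sf_sum 1 m.+1 (fun k => sf_sum 1 m.+1 (fun l =>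
       sf_mul (sf_mul (V.1 i j) (W.1 k l))
              (sf_mul (sf_add (sf_const n 1) (sf_opp (theta2 n))) (round n i j k l)))))))
    (sf_sum 1 (2 * n).+1 (fun a => sf_sum 1 (2 * n).+1 (fun b =>
       sf_mul (sf_mul (V.2 a) (sf_inv (W.2 b))) (gS n a b)))).

(* Main.v *)
(** Evaluated at a point, superfunctions live in the Grassmann algebra over R, and
    [piS F] at [x] is [gphi] of the jet [j |-> E^j F(x)], where [E = (1/2r) d/dr].
    Since [E] is a derivation and [theta^(2n+2) = 0], the projection is
    multiplicative; since [E] commutes with the rotations [L_ij] (i, j <= m), so
    does the projection; and [d_{y^b} theta^2 = 2 y_b] gives
    [d_{y^b} phi(F) = phi(d_{X^b} F) - 2 y_b phi(E F)].  On the unit sphere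
    [phi(x_i) = xi_i sqrt(1 - theta^2)] and [phi(r^2) = 1 - theta^2], so applying
    [phi] to [sum_l x_l L_li = r^2 (d_i - 2 x_i E)] turns the mixed field [J_ij]
    into [L_ij].  For the metrics, both sides are bilinear combinations of the
    projected coordinates; on the odd side [<d_{y^j}, d_{y^l}>] is the flat value
    plus [y_j y_l / (1 - theta^2)], and the correction terms cancel by
    anticommutativity or against the tangential projection of the even part. *)
Require Import Defs.
From HB Require Import structures.
From Stdlib Require Import Reals Lra ClassicalEpsilon.
From mathcomp Require Import ssreflect ssrfun ssrbool eqtype ssrnat seq choice fintype finset bigop.
From mathcomp Require Import binomial ssralg boolp Rstruct zify.
From Coquelicot Require Hierarchy Continuity Derive Derive_2d.
Import GRing.Theory.
Open Scope R_scope.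

(** * Smooth functions away from the origin *)

(** The operator [Erad] divides by [r2], so even a coordinate function leaves the class [Cinf] after
    one step. All analysis is therefore done where [r2] does not vanish: this set is open and
    contains the unit sphere. Partial derivatives are chosen by [epsilon], so every rule for them
    has to carry a proof that the derivative exists.

    Analysis and algebra are kept apart. Rules for iterates of [E] are proved for real functions;
    the laws of [gphi] are proved for arbitrary sequences in the Grassmann algebra, where only the
    coefficients [(-1)^j / j!] matter. They make the projection the formal exponential of
    [- theta^2 E], which is why a derivation [E] yields a multiplicative map.

    The binomial coefficients in [sq] and [isq] come from homogeneity: [E] multiplies a function of
    degree [d] by [d / (2 r^2)]. Iterated on [x_i] (degree 1) and on [x_i / r^2] (degree -1), it
    produces the falling factorials of 1/2 and -1/2. *)

Section Smooth.
Variable m : nat.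
Implicit Types (f g : Pt -> R) (x y : Pt).

Definition punctured x := r2 m x <> 0.
(** A point is an infinite sequence of which only the first [m] entries are coordinates; this is the
    neighbourhood used in [contm]. *)
Definition close (d : R) x y := forall k, (k < m)%N -> Rabs (y k - x k) < d.
Definition contat f x := forall eps, 0 < eps -> exists d, 0 < d /\
  forall y, close d x y -> Rabs (f y - f x) < eps.
Definition has_pd k f x l := derivable_pt_lim (fun t => f (upd x k t)) (x k) l.

Lemma contat_comp2 (op : R -> R -> R) f g x :
  Continuity.continuity_2d_pt op (f x) (g x) -> contat f x -> contat g x ->
  contat (fun y => op (f y) (g y)) x.
Proof.
move=> cop cf cg eps e0; have [d hd] := cop (mkposreal _ e0).
have [d1 [d10 h1]] := cf d (cond_pos d); have [d2 [d20 h2]] := cg d (cond_pos d).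
exists (Rmin d1 d2); split; first exact: Rmin_pos.
move=> y yx; apply: hd; [apply: h1 | apply: h2] => k km; apply: Rlt_le_trans (yx k km) _.
  exact: Rmin_l.
exact: Rmin_r.
Qed.

Lemma contat_const c x : contat (fun _ => c) x.
Proof.
move=> eps e0; exists 1; split=> [|y _]; first lra.
by rewrite Rminus_diag Rabs_R0.
Qed.

Lemma contat_coord k x : (k < m)%N -> contat (fun y => y k) x.
Proof. by move=> km eps e0; exists eps; split => // y; apply. Qed.

Lemma contat_add f g x : contat f x -> contat g x -> contat (fun y => f y + g y) x.
Proof.
apply: contat_comp2; apply: Continuity.continuity_2d_pt_plus.
  exact: Continuity.continuity_2d_pt_id1.
exact: Continuity.continuity_2d_pt_id2.
Qed.

Lemma contat_mul f g x : contat f x -> contat g x -> contat (fun y => f y * g y) x.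
Proof.
apply: contat_comp2; apply: Continuity.continuity_2d_pt_mult.
  exact: Continuity.continuity_2d_pt_id1.
exact: Continuity.continuity_2d_pt_id2.
Qed.

Lemma contat_inv f x : f x <> 0 -> contat f x -> contat (fun y => / f y) x.
Proof.
move=> fx cf; apply: (contat_comp2 (fun u _ => / u) f f) => //.
by apply: Continuity.continuity_2d_pt_inv => //; apply: Continuity.continuity_2d_pt_id1.
Qed.

Lemma contat_sum (I : Type) (s : seq I) (F : I -> Pt -> R) x :
  (forall i, contat (F i) x) -> contat (fun y => \big[Rplus/0]_(i <- s) F i y) x.
Proof.
move=> cF; elim: s => [|i s IH].
  by under eq_fun do rewrite big_nil; apply: contat_const.
by under eq_fun do rewrite big_cons; apply: contat_add.
Qed.

Lemma contat_r2 x : contat (r2 m) x.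
Proof.
apply: contat_sum => k /=; rewrite /pow.
by do !apply: contat_mul; try exact: contat_const; apply: contat_coord.
Qed.

Lemma U_open x : punctured x -> exists d, 0 < d /\ forall y, close d x y -> punctured y.
Proof.
move=> Ux; have [d [d0 hd]] := contat_r2 x _ (Rabs_pos_lt _ Ux).
exists d; split=> // y /hd; rewrite /punctured => h r0; move: h; rewrite r0.
by rewrite Rminus_0_l Rabs_Ropp; apply: Rlt_irrefl.
Qed.

Lemma upd_id x k : upd x k (x k) = x.
Proof. by apply/funext => i; rewrite /upd; case: eqP => // ->. Qed.

Lemma close_upd x k t d : 0 < d -> Rabs (t - x k) < d -> close d x (upd x k t).
Proof.
move=> d0 h i _; rewrite /upd; case: eqP => [->//|_].
by rewrite Rminus_diag Rabs_R0.
Qed.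

Lemma contat_ext f g x : punctured x -> (forall y, punctured y -> f y = g y) -> contat f x -> contat g x.
Proof.
move=> Ux fg cf eps e0; have [d1 [d10 h1]] := U_open _ Ux; have [d2 [d20 h2]] := cf _ e0.
exists (Rmin d1 d2); split; first exact: Rmin_pos.
move=> y yx; rewrite -!fg //.
  by apply: h2 => k km; apply: Rlt_le_trans (yx k km) (Rmin_r _ _).
by apply: h1 => k km; apply: Rlt_le_trans (yx k km) (Rmin_l _ _).
Qed.

Lemma dlim_eq h t l : derivable_pt_lim h t l -> dlim h t = l.
Proof.
move=> hl; apply: (uniqueness_limite h t) => //.
by rewrite /dlim; apply: epsilon_spec; exists l.
Qed.

Lemma pd_eq k f x l : has_pd k f x l -> pd k f x = l.
Proof. exact: dlim_eq. Qed.

Lemma has_pd_ext k f g x l : punctured x -> (forall y, punctured y -> f y = g y) ->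
  has_pd k f x l -> has_pd k g x l.
Proof.
move=> Ux fg hf eps e0; have [d1 [d10 h1]] := U_open _ Ux; have [d2 h2] := hf _ e0.
have dp : 0 < Rmin d1 d2 by apply: Rmin_pos => //; apply: cond_pos.
exists (mkposreal _ dp) => h h0 /= hd; rewrite upd_id -!fg //.
  by have := h2 h h0; rewrite upd_id; apply; apply: Rlt_le_trans hd (Rmin_r _ _).
apply: h1; apply: close_upd => //; rewrite Rplus_minus_l.
exact: Rlt_le_trans hd (Rmin_l _ _).
Qed.

Lemma has_pd_const k c x : has_pd k (fun _ => c) x 0.
Proof. exact: derivable_pt_lim_const. Qed.

Lemma has_pd_coord k i x : has_pd k (fun y => y i) x (if i == k then 1 else 0).
Proof.
rewrite /has_pd /upd; case: ifP => _; first exact: derivable_pt_lim_id.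
exact: derivable_pt_lim_const.
Qed.

Lemma has_pd_add k f g x a b : has_pd k f x a -> has_pd k g x b ->
  has_pd k (fun y => f y + g y) x (a + b).
Proof. exact: derivable_pt_lim_plus. Qed.

Lemma has_pd_mul k f g x a b : has_pd k f x a -> has_pd k g x b ->
  has_pd k (fun y => f y * g y) x (a * g x + f x * b).
Proof. by move=> ha hb; have := derivable_pt_lim_mult _ _ _ _ _ ha hb; rewrite upd_id. Qed.

Lemma has_pd_inv k f x a : f x <> 0 -> has_pd k f x a ->
  has_pd k (fun y => / f y) x (- a * (/ f x * / f x)).
Proof.
move=> fx ha; have := derivable_pt_lim_div _ _ _ _ _ (derivable_pt_lim_const 1 (x k)) ha.
rewrite upd_id => /(_ fx) h; have -> : - a * (/ f x * / f x) = (0 * f x - a * fct_cte 1 (x k)) / (f x)² .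
  by rewrite /fct_cte /Rsqr; field.
rewrite /has_pd (_ : (fun t => / f (upd x k t)) =
  (fct_cte 1 / (fun t => f (upd x k t)))%F); first exact: h.
by apply/funext => t; rewrite /div_fct /fct_cte /Rdiv Rmult_1_l.
Qed.

(** Class C^p on the punctured space. Recursion on the order, instead of a quantifier over lists of
    derivatives as in [Cinf], makes each closure property one induction on [p]. Continuity is asked
    at every level because the existence of partial derivatives does not imply it. *)
Fixpoint smk (p : nat) f : Prop := (forall x, punctured x -> contat f x) /\
  match p with
  | 0%N => True
  | q.+1 => forall k, (k < m)%N -> (forall x, punctured x -> exists l, has_pd k f x l) /\ smk q (pd k f)
  end.

Lemma smk_cont p f x : smk p f -> punctured x -> contat f x.
Proof. by case: p => [|p] [h _]; apply: h. Qed.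

Lemma pd_ext k f g x : punctured x -> (forall y, punctured y -> f y = g y) ->
  (exists l, has_pd k f x l) -> pd k f x = pd k g x.
Proof.
move=> Ux fg [l hl]; rewrite (pd_eq _ _ _ _ hl); symmetry; apply: pd_eq.
exact: has_pd_ext hl.
Qed.

(** Identities such as [r2 * / r2 = 1] fail at the origin, so functions are exchanged when they
    agree on the punctured set only; its openness transfers limits and derivatives. *)
Lemma smk_ext p f g : (forall x, punctured x -> f x = g x) -> smk p f -> smk p g.
Proof.
elim: p f g => [|p IH] f g fg [cf df]; split=> //; try by move=> x Ux; apply: contat_ext (cf x Ux).
move=> k km; have [ex sp] := df k km; split.
  by move=> x Ux; have [l hl] := ex x Ux; exists l; apply: has_pd_ext hl.
by apply: IH sp => x Ux; apply: pd_ext => //; apply: ex.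
Qed.

(** Allows a closed formula [f'] in place of [pd k f], with which it needs to agree only on the
    punctured set. *)
Lemma smk_intro p f : (forall x, punctured x -> contat f x) ->
  (forall k, (k < m)%N -> exists2 f', (forall x, punctured x -> has_pd k f x (f' x)) & smk p f') ->
  smk p.+1 f.
Proof.
move=> cf h; split=> // k km; have [f' hf' sf'] := h k km; split.
  by move=> x Ux; exists (f' x); apply: hf'.
by apply: smk_ext sf' => x Ux; symmetry; apply: pd_eq; apply: hf'.
Qed.

Lemma smk_S p f : smk p.+1 f -> smk p f.
Proof.
elim: p f => [|p IH] f [cf df]; first by split.
by split=> // k km; have [ex /IH sp] := df k km.
Qed.

Lemma smk_has p f k x : smk p.+1 f -> (k < m)%N -> punctured x -> has_pd k f x (pd k f x).
Proof.
by case=> _ df km Ux; have [/(_ x Ux) [l hl] _] := df k km; rewrite (pd_eq _ _ _ _ hl).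
Qed.

Lemma smk_pd p f k : smk p.+1 f -> (k < m)%N -> smk p (pd k f).
Proof. by case=> _ df km; have [] := df k km. Qed.

Lemma smk_const p c : smk p (fun _ => c).
Proof.
elim: p c => [|p IH] c; first by split=> // x _; apply: contat_const.
apply: smk_intro => [x _|k km]; first exact: contat_const.
by exists (fun _ => 0) => // x _; apply: has_pd_const.
Qed.

Lemma smk_coord p k : (k < m)%N -> smk p (fun x => x k).
Proof.
move=> km; case: p => [|p]; first by split=> // x _; apply: contat_coord.
apply: smk_intro => [x _|i im]; first exact: contat_coord.
exists (fun _ => if k == i then 1 else 0); last exact: smk_const.
by move=> x _; apply: has_pd_coord.
Qed.

Lemma smk_add p f g : smk p f -> smk p g -> smk p (fun x => f x + g x).
Proof.
elim: p f g => [|p IH] f g sf sg.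
  by split=> // x Ux; apply: contat_add; [apply: smk_cont sf Ux | apply: smk_cont sg Ux].
apply: smk_intro => [x Ux|k km].
  by apply: contat_add; [apply: smk_cont sf Ux | apply: smk_cont sg Ux].
exists (fun x => pd k f x + pd k g x).
  by move=> x Ux; apply: has_pd_add; apply: smk_has => //; eassumption.
by apply: IH; apply: smk_pd.
Qed.

Lemma smk_mul p f g : smk p f -> smk p g -> smk p (fun x => f x * g x).
Proof.
elim: p f g => [|p IH] f g sf sg.
  by split=> // x Ux; apply: contat_mul; [apply: smk_cont sf Ux | apply: smk_cont sg Ux].
apply: smk_intro => [x Ux|k km].
  by apply: contat_mul; [apply: smk_cont sf Ux | apply: smk_cont sg Ux].
exists (fun x => pd k f x * g x + f x * pd k g x).
  by move=> x Ux; apply: has_pd_mul; apply: smk_has => //; eassumption.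
by apply: smk_add; apply: IH; try (by apply: smk_pd); apply: smk_S.
Qed.

Lemma smk_inv p f : (forall x, punctured x -> f x <> 0) -> smk p f -> smk p (fun x => / f x).
Proof.
move=> f0; elim: p => [|p IH] sf.
  by split=> // x Ux; apply: contat_inv; [apply: f0 | apply: smk_cont sf Ux].
apply: smk_intro => [x Ux|k km].
  by apply: contat_inv; [apply: f0 | apply: smk_cont sf Ux].
exists (fun x => - 1 * pd k f x * (/ f x * / f x)).
  move=> x Ux; have := has_pd_inv _ _ _ _ (f0 x Ux) (smk_has _ _ _ _ sf km Ux).
  by congr has_pd; ring.
have sfi := IH (smk_S _ _ sf).
by do 2!apply: smk_mul => //; [exact: smk_const | apply: smk_pd].
Qed.

Lemma Cinf_smk f : Cinf m f -> forall p, smk p f.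
Proof.
move=> [_ h] p; have: all (fun k => (k < m)%N) [::] by [].
(* Each order of differentiability prolongs the list of derivatives, so the induction is run on
   [ipd ks f] for every [ks]. *)
rewrite -[f]/(ipd [::] f); move: [::] => ks; elim: p ks => [|p IH] ks hks.
  by split=> // x _; apply: (h ks hks).1.
split=> [x _|k km]; first exact: (h ks hks).1.
split=> [x _|]; first exact: (h ks hks).2.
by apply: (IH (k :: ks)); rewrite /= km.
Qed.

End Smooth.

(** * Planar slices: symmetry of second derivatives and the velocity of rotations *)

Section TwoVariables.
Notation is_deriveR := (@Derive.is_derive Hierarchy.R_AbsRing Hierarchy.R_NormedModule).
Variables (m i j : nat) (x : Pt).
Hypotheses (im : (i < m)%N) (jm : (j < m)%N) (ij : i != j).

(** Restriction to the coordinate plane through [x] in the directions [i] and [j], where the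
    two-variable theorems of Coquelicot apply. *)
Definition slice (u v : R) : Pt := upd (upd x i u) j v.

Lemma slice_id : slice (x i) (x j) = x.
Proof. by rewrite /slice !upd_id. Qed.

Lemma sliceT u v : slice u v = upd (upd x j v) i u.
Proof.
apply/funext => k; rewrite /slice /upd.
by case: (eqVneq k j) => // ->; rewrite eq_sym (negPf ij).
Qed.

Lemma slice_i u v : slice u v i = u.
Proof. by rewrite sliceT /upd eqxx. Qed.

Lemma slice_j u v : slice u v j = v.
Proof. by rewrite /slice /upd eqxx. Qed.

Lemma upd_slice_i u v t : upd (slice u v) i t = slice t v.
Proof. by rewrite !sliceT; apply/funext => k; rewrite /upd; case: eqP. Qed.

Lemma upd_slice_j u v t : upd (slice u v) j t = slice u t.
Proof. by apply/funext => k; rewrite /slice /upd; case: eqP. Qed.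

Lemma close_slice d u v u' v' : 0 < d -> Rabs (u' - u) < d -> Rabs (v' - v) < d ->
  close m d (slice u v) (slice u' v').
Proof.
move=> d0 hu hv k _; rewrite /slice /upd; case: eqP => // _; case: eqP => // _.
by rewrite Rminus_diag Rabs_R0.
Qed.

Lemma slice_open u v : punctured m (slice u v) ->
  Hierarchy.locally_2d (fun a b => punctured m (slice a b)) u v.
Proof.
move=> Uz; have [d [d0 hd]] := U_open _ _ Uz.
by exists (mkposreal d d0) => a b ha hb; apply: hd; apply: close_slice.
Qed.

Lemma slice_cont g u v : contat m g (slice u v) ->
  Continuity.continuity_2d_pt (fun a b => g (slice a b)) u v.
Proof.
move=> cg eps; have [d [d0 hd]] := cg eps (cond_pos eps).
by exists (mkposreal d d0) => a b ha hb; apply: hd; apply: close_slice.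
Qed.

Lemma slice_der_i p g u v : smk m p.+1 g -> punctured m (slice u v) ->
  is_deriveR (fun t => g (slice t v)) u (pd i g (slice u v)).
Proof.
move=> sg Uz; apply/Derive.is_derive_Reals.
have := smk_has _ _ _ _ _ sg im Uz; rewrite /has_pd slice_i.
by under eq_fun do rewrite upd_slice_i.
Qed.

Lemma slice_der_j p g u v : smk m p.+1 g -> punctured m (slice u v) ->
  is_deriveR (fun t => g (slice u t)) v (pd j g (slice u v)).
Proof.
move=> sg Uz; apply/Derive.is_derive_Reals.
have := smk_has _ _ _ _ _ sg jm Uz; rewrite /has_pd slice_j.
by under eq_fun do rewrite upd_slice_j.
Qed.

Lemma slice_der2_ij g u v : smk m 2 g -> punctured m (slice u v) ->
  is_deriveR (fun a => Derive.Derive (fun b => g (slice a b)) v) u (pd i (pd j g) (slice u v)).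
Proof.
move=> sg Uz; have sg1 := smk_pd _ _ _ _ sg jm.
apply: Derive.is_derive_ext_loc (slice_der_i _ _ _ _ sg1 Uz).
have [d hd] := slice_open _ _ Uz; exists d => a ha.
symmetry; apply: Derive.is_derive_unique; apply: slice_der_j sg _; apply: hd => //.
by rewrite Rminus_diag Rabs_R0; apply: cond_pos.
Qed.

Lemma slice_der2_ji g u v : smk m 2 g -> punctured m (slice u v) ->
  is_deriveR (fun b => Derive.Derive (fun a => g (slice a b)) u) v (pd j (pd i g) (slice u v)).
Proof.
move=> sg Uz; have sg1 := smk_pd _ _ _ _ sg im.
apply: Derive.is_derive_ext_loc (slice_der_j _ _ _ _ sg1 Uz).
have [d hd] := slice_open _ _ Uz; exists d => a ha.
symmetry; apply: Derive.is_derive_unique; apply: slice_der_i sg _; apply: hd => //.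
by rewrite Rminus_diag Rabs_R0; apply: cond_pos.
Qed.

Lemma pd_comm_neq g : smk m 2 g -> punctured m x -> pd i (pd j g) x = pd j (pd i g) x.
Proof.
move=> sg Ux; have Uz : punctured m (slice (x i) (x j)) by rewrite slice_id.
have op := slice_open _ _ Uz.
have := Derive.is_derive_unique _ _ _ (slice_der2_ij _ _ _ sg Uz).
have := Derive.is_derive_unique _ _ _ (slice_der2_ji _ _ _ sg Uz).
rewrite slice_id => <- <-.
apply: Derive_2d.Schwarz.
- apply: Hierarchy.locally_2d_impl op; apply: Hierarchy.locally_2d_forall => u v Uv.
  split; [|split; [|split]]; eexists.
  + exact: slice_der_i sg Uv.
  + exact: slice_der_j sg Uv.
  + exact: slice_der2_ij sg Uv.
  + exact: slice_der2_ji sg Uv.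
- apply: Continuity.continuity_2d_pt_ext_loc (slice_cont (pd i (pd j g)) _ _ _).
    apply: Hierarchy.locally_2d_impl op; apply: Hierarchy.locally_2d_forall => u v Uv.
    by symmetry; apply: Derive.is_derive_unique; apply: slice_der2_ij.
  exact: (smk_cont m 0 _ _ (smk_pd _ _ _ _ (smk_pd _ _ _ _ sg jm) im)).
- apply: Continuity.continuity_2d_pt_ext_loc (slice_cont (pd j (pd i g)) _ _ _).
    apply: Hierarchy.locally_2d_impl op; apply: Hierarchy.locally_2d_forall => u v Uv.
    by symmetry; apply: Derive.is_derive_unique; apply: slice_der2_ji.
  exact: (smk_cont m 0 _ _ (smk_pd _ _ _ _ (smk_pd _ _ _ _ sg im) jm)).
Qed.

(** Total differentiability, which the chain rule demands, follows from one partial derivative that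
    exists nearby and is continuous, and the other one existing at the point. *)
Lemma slice_differentiable g : smk m 1 g -> punctured m x ->
  Derive_2d.differentiable_pt_lim (fun u v => g (slice u v)) (x i) (x j) (pd i g x) (pd j g x).
Proof.
move=> sg Ux; have Uz : punctured m (slice (x i) (x j)) by rewrite slice_id.
apply/Derive_2d.filterdiff_differentiable_pt_lim.
have := Derive.is_derive_filterdiff (fun u v => g (slice u v)) (x i) (x j)
  (fun u v => pd i g (slice u v)) (pd j g x).
rewrite slice_id; apply.
- apply/(Hierarchy.locally_2d_locally (fun u v => is_deriveR (fun z => g (slice z v)) u (pd i g (slice u v)))).
  apply: Hierarchy.locally_2d_impl (slice_open _ _ Uz).
  by apply: Hierarchy.locally_2d_forall => u v Uv; apply: slice_der_i sg Uv.
- by have := slice_der_j _ _ _ _ sg Uz; rewrite slice_id.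
- apply/(Continuity.continuity_2d_pt_filterlim (fun u v => pd i g (slice u v))).
  by apply: slice_cont; apply: (smk_cont m 0) Uz; apply: smk_pd.
Qed.

(** The rotation moves only the coordinates [i] and [j], so it is a curve in the slice, with
    velocity [(- x j, x i)] at time 0. *)
Lemma rot_der g : smk m 1 g -> punctured m x ->
  derivable_pt_lim (fun t => g (Defs.rot i j t x)) 0 (x i * pd j g x - x j * pd i g x).
Proof.
move=> sg Ux.
have -> : (fun t => g (Defs.rot i j t x)) =
    (fun t => g (slice (cos t * x i - sin t * x j) (cos t * x j + sin t * x i))).
  apply/funext => t; congr g; apply/funext => k; rewrite /Defs.rot (negPf ij) sliceT /upd.
  by case: eqP.
have cE : derivable_pt_lim cos 0 0.
  by have := derivable_pt_lim_cos 0; rewrite sin_0 Ropp_0.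
have sE : derivable_pt_lim sin 0 1.
  by have := derivable_pt_lim_sin 0; rewrite cos_0.
have d2 (f : R -> R) l c : derivable_pt_lim f 0 l -> derivable_pt_lim (fun t => f t * c) 0 (l * c).
  move=> fl; have := derivable_pt_lim_mult _ _ _ _ _ fl (derivable_pt_lim_const c 0).
  by rewrite Rmult_0_r Rplus_0_r.
have du : derivable_pt_lim (fun t => cos t * x i - sin t * x j) 0 (0 * x i - 1 * x j).
  by apply: derivable_pt_lim_minus; apply: d2.
have dv : derivable_pt_lim (fun t => cos t * x j + sin t * x i) 0 (0 * x j + 1 * x i).
  by apply: derivable_pt_lim_plus; apply: d2.
have df := slice_differentiable _ sg Ux.
have := Derive_2d.derivable_pt_lim_comp_2d (fun u v => g (slice u v)) _ _ 0 _ _ _ _ _ du dv.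
move=> /(_ (pd i g x) (pd j g x)).
rewrite cos_0 sin_0 !Rmult_1_l !Rmult_0_l Rminus_0_r Rplus_0_r => /(_ df).
by congr derivable_pt_lim; ring.
Qed.

End TwoVariables.

(** * The radial derivation [E] and its iterates *)

Section RadialDerivation.
Variable m : nat.
Implicit Types (f g : Pt -> R) (x y : Pt).
Notation U := (punctured m).
Notation E := (Erad m).

Definition smooth f := forall p, smk m p f.

Lemma smooth_const c : smooth (fun _ => c). Proof. by move=> p; apply: smk_const. Qed.
Lemma smooth_coord k : (k < m)%N -> smooth (fun x => x k).
Proof. by move=> km p; apply: smk_coord. Qed.
Lemma smooth_add f g : smooth f -> smooth g -> smooth (fun x => f x + g x).
Proof. by move=> sf sg p; apply: smk_add. Qed.
Lemma smooth_mul f g : smooth f -> smooth g -> smooth (fun x => f x * g x).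
Proof. by move=> sf sg p; apply: smk_mul. Qed.
Lemma smooth_inv f : (forall x, U x -> f x <> 0) -> smooth f -> smooth (fun x => / f x).
Proof. by move=> f0 sf p; apply: smk_inv. Qed.
Lemma smooth_pd f k : (k < m)%N -> smooth f -> smooth (pd k f).
Proof. by move=> km sf p; apply: smk_pd (sf p.+1) km. Qed.
Lemma smooth_scale c f : smooth f -> smooth (fun x => c * f x).
Proof. by move=> sf; apply: smooth_mul sf; apply: smooth_const. Qed.
Lemma smooth_pow f p : smooth f -> smooth (fun x => f x ^ p).
Proof.
by move=> sf; elim: p => [|p IH]; [apply: smooth_const | apply: smooth_mul].
Qed.
Lemma smooth_sum (I : Type) (s : seq I) (F : I -> Pt -> R) :
  (forall i, smooth (F i)) -> smooth (fun x => \big[Rplus/0]_(i <- s) F i x).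
Proof.
move=> sF; elim: s => [|i s IH].
  by under eq_fun do rewrite big_nil; apply: smooth_const.
by under eq_fun do rewrite big_cons; apply: smooth_add.
Qed.
Lemma smooth_r2 : smooth (r2 m).
Proof. by apply: smooth_sum => k; apply: smooth_pow; apply: smooth_coord. Qed.

Lemma smooth_has k f x : smooth f -> (k < m)%N -> U x -> has_pd k f x (pd k f x).
Proof. by move=> sf; apply: (smk_has _ 0). Qed.

Lemma eq_pd k f g x : (k < m)%N -> smooth f -> U x -> (forall y, U y -> f y = g y) ->
  pd k f x = pd k g x.
Proof.
by move=> km sf Ux fg; apply: (pd_ext m) => //; exists (pd k f x); apply: smooth_has.
Qed.

Lemma pd_const k c x : pd k (fun _ => c) x = 0.
Proof. by apply: pd_eq; apply: has_pd_const. Qed.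

Lemma pd_coord k i x : pd k (fun y => y i) x = if i == k then 1 else 0.
Proof. by apply: pd_eq; apply: has_pd_coord. Qed.

Lemma pdD k f g x : (k < m)%N -> smooth f -> smooth g -> U x ->
  pd k (fun y => f y + g y) x = pd k f x + pd k g x.
Proof. by move=> km sf sg Ux; apply: pd_eq; apply: has_pd_add; apply: smooth_has. Qed.

Lemma pdM k f g x : (k < m)%N -> smooth f -> smooth g -> U x ->
  pd k (fun y => f y * g y) x = pd k f x * g x + f x * pd k g x.
Proof. by move=> km sf sg Ux; apply: pd_eq; apply: has_pd_mul; apply: smooth_has. Qed.

Lemma pdZ k c f x : (k < m)%N -> smooth f -> U x -> pd k (fun y => c * f y) x = c * pd k f x.
Proof.
move=> km sf Ux; rewrite pdM //; last exact: smooth_const.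
by rewrite pd_const; ring.
Qed.

Lemma pdV k f x : (k < m)%N -> smooth f -> U x -> f x <> 0 ->
  pd k (fun y => / f y) x = - pd k f x * (/ f x * / f x).
Proof. by move=> km sf Ux fx; apply: pd_eq; apply: has_pd_inv => //; apply: smooth_has. Qed.

Lemma pd_sum k (I : Type) (s : seq I) (F : I -> Pt -> R) x :
  (k < m)%N -> (forall i, smooth (F i)) -> U x ->
  pd k (fun y => \big[Rplus/0]_(i <- s) F i y) x = \big[Rplus/0]_(i <- s) pd k (F i) x.
Proof.
move=> km sF Ux; elim: s => [|i s IH].
  by under eq_fun do rewrite big_nil; rewrite big_nil pd_const.
under eq_fun do rewrite big_cons.
by rewrite big_cons pdD ?IH //; apply: smooth_sum.
Qed.

Lemma pdC i j f x : (i < m)%N -> (j < m)%N -> smooth f -> U x ->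
  pd i (pd j f) x = pd j (pd i f) x.
Proof.
move=> im jm sf Ux; case: (eqVneq i j) => [->//|ij].
by apply: (pd_comm_neq m) => //; apply: sf.
Qed.

Lemma sum_delta k (F : nat -> R) : (k < m)%N ->
  \big[Rplus/0]_(i < m) ((if k == i then 1 else 0) * F i) = F k.
Proof.
move=> km; rewrite (bigD1 (Ordinal km)) //= eqxx big1 => [|i]; first ring.
by rewrite -val_eqE /= eq_sym => /negPf ->; ring.
Qed.

Lemma pd_r2 k x : (k < m)%N -> U x -> pd k (r2 m) x = 2 * x k.
Proof.
move=> km Ux; rewrite /r2 /rsum pd_sum //; last first.
  by move=> i; apply: smooth_pow; apply: smooth_coord.
rewrite -[RHS](sum_delta k (fun i => 2 * x i)) //; apply: eq_bigr => i _ /=.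
have si := smooth_coord i (ltn_ord i).
rewrite pdM //; last by apply: smooth_mul si _; apply: smooth_const.
rewrite pdM //; last exact: smooth_const.
by rewrite pd_const pd_coord eq_sym; case: ifP => _; ring.
Qed.

Lemma smooth_E f : smooth f -> smooth (E f).
Proof.
move=> sf; apply: smooth_mul.
  apply: smooth_inv; first by move=> x Ux; apply: Rmult_integral_contrapositive_currified => //; lra.
  by apply: smooth_scale; apply: smooth_r2.
by apply: smooth_sum => k; apply: smooth_mul; [apply: smooth_coord | apply: smooth_pd].
Qed.

Lemma eq_E f g x : smooth f -> U x -> (forall y, U y -> f y = g y) -> E f x = E g x.
Proof.
move=> sf Ux fg; rewrite /Erad; congr (_ * _); apply: eq_bigr => k _.
by rewrite (eq_pd _ f g).
Qed.

Lemma E_const c x : E (fun _ => c) x = 0.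
Proof.
rewrite /Erad /rsum big1 ?Rmult_0_r // => k _.
by rewrite pd_const Rmult_0_r.
Qed.

Lemma E_add f g x : smooth f -> smooth g -> U x -> E (fun y => f y + g y) x = E f x + E g x.
Proof.
move=> sf sg Ux; rewrite /Erad -Rmult_plus_distr_l /rsum -big_split; congr (_ * _).
by apply: eq_bigr => k _ /=; rewrite pdD // Rmult_plus_distr_l.
Qed.

Lemma E_mul f g x : smooth f -> smooth g -> U x -> E (fun y => f y * g y) x = E f x * g x + f x * E g x.
Proof.
move=> sf sg Ux; rewrite /Erad.
have -> : rsum m (fun k => x k * pd k (fun y => f y * g y) x) =
    rsum m (fun k => x k * pd k f x) * g x + f x * rsum m (fun k => x k * pd k g x).
  rewrite /rsum big_distrl big_distrr -big_split; apply: eq_bigr => k _ /=.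
  by rewrite pdM //; ring.
ring.
Qed.

Lemma E_scale c f x : smooth f -> U x -> E (fun y => c * f y) x = c * E f x.
Proof.
move=> sf Ux; rewrite E_mul //; last exact: smooth_const.
by rewrite E_const; ring.
Qed.

Lemma E_r2 x : U x -> E (r2 m) x = 1.
Proof.
move=> Ux; rewrite /Erad.
have -> : rsum m (fun k => x k * pd k (r2 m) x) = 2 * r2 m x.
  by rewrite /r2 /rsum big_distrr; apply: eq_bigr => k _ /=; rewrite pd_r2 //; ring.
by field.
Qed.

Lemma E_coord i x : (i < m)%N -> E (fun y => y i) x = / (2 * r2 m x) * x i.
Proof.
move=> im; rewrite /Erad; congr (_ * _); rewrite -[RHS](sum_delta i (fun k => x k)) //.
by apply: eq_bigr => k _; rewrite pd_coord Rmult_comm.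
Qed.

Definition inv_r2 x := / r2 m x.

Lemma smooth_w : smooth inv_r2. Proof. by apply: smooth_inv => //; apply: smooth_r2. Qed.

(** Product rule for [r2 * inv_r2], which is 1 off the origin, combined with [E r2 = 1]. *)
Lemma E_w x : U x -> E inv_r2 x = - (inv_r2 x * inv_r2 x).
Proof.
move=> Ux.
have := E_mul _ _ _ smooth_r2 smooth_w Ux.
have -> : E (fun y => r2 m y * inv_r2 y) x = E (fun _ => 1) x.
  apply: eq_E => // [|y Uy]; first by apply: smooth_mul; [apply: smooth_r2 | apply: smooth_w].
  by rewrite /inv_r2; field.
rewrite E_const E_r2 // => h.
have -> : E inv_r2 x = inv_r2 x * (r2 m x * E inv_r2 x) by rewrite /inv_r2; field.
have -> : r2 m x * E inv_r2 x = - inv_r2 x by lra.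
ring.
Qed.

(** The function [x_i r^(-2q)] is homogeneous of degree [1 - 2q]; by Euler's identity [E] multiplies
    it by half the degree over [r^2]. *)
Lemma E_coord_wX i q x : (i < m)%N -> U x ->
  E (fun y => y i * inv_r2 y ^ q) x = (1 / 2 - INR q) * (x i * inv_r2 x ^ q.+1).
Proof.
move=> im Ux.
have Ewq : E (fun y => inv_r2 y ^ q) x = - INR q * inv_r2 x ^ q.+1.
  elim: q => [|q IH]; first by rewrite E_const /=; ring.
  rewrite -[LHS]/(E (fun y => inv_r2 y * inv_r2 y ^ q) x) E_mul //; [|exact: smooth_w|exact: smooth_pow smooth_w].
  by rewrite IH E_w // S_INR /=; ring.
rewrite E_mul //; [|exact: smooth_coord|exact: smooth_pow smooth_w].
by rewrite Ewq E_coord //= /inv_r2; field.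
Qed.

(** Indices are 0-based. The difference is written with [-1 *] so that it unfolds to the same
    expression as [Lf] with its sign -1. *)
Definition Lop (i j : nat) f : Pt -> R := fun x => x i * pd j f x + -1 * (x j * pd i f x).

Lemma smooth_Lop i j f : (i < m)%N -> (j < m)%N -> smooth f -> smooth (Lop i j f).
Proof.
move=> im jm sf; apply: smooth_add; last apply: smooth_scale; apply: smooth_mul;
  by [apply: smooth_coord | apply: smooth_pd].
Qed.

Lemma Lop_sum i j (I : Type) (s : seq I) (F : I -> Pt -> R) x :
  (i < m)%N -> (j < m)%N -> (forall a, smooth (F a)) -> U x ->
  Lop i j (fun y => \big[Rplus/0]_(a <- s) F a y) x = \big[Rplus/0]_(a <- s) Lop i j (F a) x.
Proof.
by move=> im jm sF Ux; rewrite /Lop !pd_sum // !big_distrr -big_split.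
Qed.

Lemma Lop_scale i j c f x : (i < m)%N -> (j < m)%N -> smooth f -> U x ->
  Lop i j (fun y => c * f y) x = c * Lop i j f x.
Proof. by move=> im jm sf Ux; rewrite /Lop !pdZ //; ring. Qed.

(* Rotations commute with the Euler field and kill [r2]. *)
Lemma E_Lop i j f x : (i < m)%N -> (j < m)%N -> smooth f -> U x ->
  E (Lop i j f) x = Lop i j (E f) x.
Proof.
move=> im jm sf Ux.
have sk (k : 'I_m) : smooth (fun y => y k * pd k f y).
  by apply: smooth_mul; [apply: smooth_coord | apply: smooth_pd].
have r20 y : U y -> 2 * r2 m y <> 0.
  by move=> Uy; apply: Rmult_integral_contrapositive_currified => //; lra.
have sc : smooth (fun y => / (2 * r2 m y)) by apply: smooth_inv r20 _; apply: smooth_scale; apply: smooth_r2.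
(* The first summand, from differentiating [1 / (2 r^2)], is proportional to [x a], so it drops out
   of [x i pd_j - x j pd_i]. *)
have pdE a : (a < m)%N -> pd a (E f) x =
    - (x a * / (r2 m x * r2 m x)) * rsum m (fun k => x k * pd k f x) +
    / (2 * r2 m x) * (pd a f x + \big[Rplus/0]_(k < m) (x k * pd a (pd k f) x)).
  move=> am; rewrite [LHS]pdM //; last exact: smooth_sum.
  congr (_ * _ + _ * _).
    rewrite pdV //; [|by apply: smooth_scale; apply: smooth_r2|exact: r20].
    by rewrite pdZ ?pd_r2 //; [field | exact: smooth_r2].
  rewrite pd_sum // -(sum_delta a (fun k => pd k f x)) // -big_split; apply: eq_bigr => k _ /=.
  rewrite pdM //; [|exact: smooth_coord|exact: smooth_pd].
  by rewrite pd_coord eq_sym.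
rewrite /Lop !pdE //.
have pdL (k : 'I_m) : x k * pd k (Lop i j f) x =
   (if i == k then 1 else 0) * (x k * pd j f x) + -1 * ((if j == k then 1 else 0) * (x k * pd i f x)) +
   (x i * (x k * pd j (pd k f) x) + -1 * (x j * (x k * pd i (pd k f) x))).
  have sj := smooth_pd _ _ jm sf; have si := smooth_pd _ _ im sf.
  have xi := smooth_coord _ im; have xj := smooth_coord _ jm.
  rewrite pdD ?pdZ ?pdM ?pd_coord //; try exact: smooth_mul; last by apply: smooth_scale; apply: smooth_mul.
  by rewrite (pdC k j) // (pdC k i) //; ring.
rewrite {1}/Erad {1}/rsum (eq_bigr _ (fun k _ => pdL k)) !big_split -!big_distrr /=.
rewrite (sum_delta i (fun k => x k * pd j f x)) // (sum_delta j (fun k => x k * pd i f x)) //.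
ring.
Qed.

Lemma smooth_iterE p f : smooth f -> smooth (iter p E f).
Proof. by move=> sf; elim: p => //= p; apply: smooth_E. Qed.

Lemma eq_iterE p f g x : smooth f -> smooth g -> U x -> (forall y, U y -> f y = g y) ->
  iter p E f x = iter p E g x.
Proof.
move=> sf sg Ux fg; elim: p x Ux => [|p IH] x Ux /=; first exact: fg.
by apply: eq_E => //; apply: smooth_iterE.
Qed.

Lemma iterE_const p c x : U x -> iter p.+1 E (fun _ => c) x = 0.
Proof.
elim: p x => [|p IH] x Ux; first exact: E_const.
rewrite iterS -(E_const 0 x); apply: eq_E => //.
by apply: smooth_iterE; apply: smooth_const.
Qed.

Lemma iterE_add p f g x : smooth f -> smooth g -> U x ->
  iter p E (fun y => f y + g y) x = iter p E f x + iter p E g x.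
Proof.
move=> sf sg; elim: p x => [|p IH] x Ux //=.
rewrite -E_add //; try exact: smooth_iterE.
by apply: eq_E => //; apply: smooth_iterE; apply: smooth_add.
Qed.

Lemma iterE_scale p c f x : smooth f -> U x ->
  iter p E (fun y => c * f y) x = c * iter p E f x.
Proof.
move=> sf; elim: p x => [|p IH] x Ux //=.
rewrite -E_scale //; try exact: smooth_iterE.
by apply: eq_E => //; apply: smooth_iterE; apply: smooth_scale.
Qed.

Lemma iterE_Lop p i j f x : (i < m)%N -> (j < m)%N -> smooth f -> U x ->
  iter p E (Lop i j f) x = Lop i j (iter p E f) x.
Proof.
move=> im jm sf; elim: p x => [|p IH] x Ux //=.
rewrite -E_Lop //; try exact: smooth_iterE.
by apply: eq_E => //; apply: smooth_iterE; apply: smooth_Lop.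
Qed.

Lemma E_sum (I : Type) (s : seq I) (F : I -> Pt -> R) x :
  (forall i, smooth (F i)) -> U x ->
  E (fun y => \big[Rplus/0]_(i <- s) F i y) x = \big[Rplus/0]_(i <- s) E (F i) x.
Proof.
move=> sF Ux; elim: s => [|i s IH].
  by under eq_fun do rewrite big_nil; rewrite big_nil E_const.
under eq_fun do rewrite big_cons.
by rewrite big_cons E_add ?IH //; apply: smooth_sum.
Qed.

Lemma iterE_sum p (I : Type) (s : seq I) (F : I -> Pt -> R) x :
  (forall i, smooth (F i)) -> U x ->
  iter p E (fun y => \big[Rplus/0]_(i <- s) F i y) x = \big[Rplus/0]_(i <- s) iter p E (F i) x.
Proof.
move=> sF; elim: p x => [|p IH] x Ux //=.
rewrite -E_sum //; last by move=> i; apply: smooth_iterE.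
by apply: eq_E => //; apply: smooth_iterE; apply: smooth_sum.
Qed.

Lemma iterE_mul p f g x : smooth f -> smooth g -> U x ->
  iter p E (fun y => f y * g y) x =
  \big[Rplus/0]_(a < p.+1) (INR 'C(p, a) * iter a E f x * iter (p - a) E g x).
Proof.
move=> sf sg; elim: p x => [|p IH] x Ux.
  by rewrite big_ord1 /=; ring.
have st (a : 'I_p.+1) : smooth (fun y => INR 'C(p, a) * iter a E f y * iter (p - a) E g y).
  by apply: smooth_mul; [apply: smooth_scale|]; apply: smooth_iterE.
rewrite iterS (eq_E _ (fun y => \big[Rplus/0]_(a < p.+1) (INR 'C(p, a) * iter a E f y * iter (p - a) E g y))) //;
  last by apply: smooth_iterE; apply: smooth_mul.
rewrite E_sum //.
pose c a b := iter a E f x * iter b E g x.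
transitivity (\big[Rplus/0]_(a < p.+1) (INR 'C(p, a) * c a.+1 (p - a)%N) +
   \big[Rplus/0]_(a < p.+1) (INR 'C(p, a) * c a (p.+1 - a)%N)).
  rewrite -big_split; apply: eq_bigr => a _; rewrite /c /=.
  rewrite E_mul //; [|by apply: smooth_scale; apply: smooth_iterE|exact: smooth_iterE].
  rewrite E_scale //; last exact: smooth_iterE.
  have -> : (p.+1 - a)%N = (p - a).+1 by rewrite subSn // -ltnS.
  by rewrite /=; ring.
(* The added term has the factor ['C(p, p.+1) = 0]. Once the first term is split off, the sum runs
   over the same range as the other one, ready for Pascal's rule. *)
have -> : \big[Rplus/0]_(a < p.+1) (INR 'C(p, a) * c a (p.+1 - a)%N) =
   \big[Rplus/0]_(a < p.+2) (INR 'C(p, a) * c a (p.+1 - a)%N).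
  by rewrite [RHS]big_ord_recr /= bin_small // Rmult_0_l Rplus_0_r.
rewrite [X in _ + X = _]big_ord_recl [RHS]big_ord_recl -Rplus_assoc (Rplus_comm (bigop _ _ _)) Rplus_assoc /=.
rewrite !bin0 /c /=; congr (_ + _); first ring.
rewrite -big_split; apply: eq_bigr => a _ /=; rewrite /bump /= add1n binS plus_INR subSS.
by rewrite add0n; ring.
Qed.

(** On the unit sphere the power of [inv_r2] is 1 and the falling factorial of [1/2 - q] remains,
    the numerator of [gbinom]. *)
Lemma iterE_coord_wX p i q x : (i < m)%N -> U x ->
  iter p E (fun y => y i * inv_r2 y ^ q) x =
  \big[Rmult/1]_(k < p) (1 / 2 - INR q - INR k) * (x i * inv_r2 x ^ (q + p)).
Proof.
move=> im; elim: p x => [|p IH] x Ux; first by rewrite big_ord0 addn0 /=; ring.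
have sx a : smooth (fun y => y i * inv_r2 y ^ a).
  by apply: smooth_mul; [apply: smooth_coord | apply: smooth_pow; apply: smooth_w].
rewrite iterS (eq_E _ (fun y => \big[Rmult/1]_(k < p) (1 / 2 - INR q - INR k) * (y i * inv_r2 y ^ (q + p)))) //; last exact: smooth_iterE.
rewrite E_scale // E_coord_wX // big_ord_recr addnS /= plus_INR; ring.
Qed.

End RadialDerivation.

Lemma Rmult_div_split (x y a b c : R) : a <> 0 -> b <> 0 -> c <> 0 ->
  x * y * / (c * a * b) * c = x * / a * (y * / b).
Proof. by move=> *; field. Qed.

Lemma Rminus_scale (a b : R) : a - b = a + -1 * b.
Proof. ring. Qed.
Lemma Rplus_opp_r_scale (a : R) : 0 = a + -1 * a.
Proof. ring. Qed.

(** With [d k = y_k pd_k f] the inner fraction is [E f]; the factor 2 compensates the [1 / (2 r^2)]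
    in it. *)
Lemma Rtangential (m i : nat) (y : Pt) (a : R) (d : nat -> R) : r2 m y <> 0 ->
  r2 m y * a + -1 * y i * rsum m d =
  r2 m y * (a + -2 * (y i * (/ (2 * r2 m y) * rsum m d))).
Proof. by move=> r0; field. Qed.

(** [ring] works with the real operations of Stdlib, so those of MathComp are first rewritten into
    them. *)
Ltac eqR := rewrite -?RinvE -?RmultE -?RplusE -?RoppE -?R0E -?R1E;
  match goal with |- @eq _ ?a ?b => change (@eq R a b) end.
Ltac ringR := eqR; ring.

Local Open Scope ring_scope.

(** * Inversion numbers of pairs of monomials *)

Section Signs.
Variable n : nat.
Implicit Types A B C S T : Mon n.

Lemma ninvE A B : ninv A B = (\sum_(a in A) \sum_(b in B) (b < a))%N.
Proof.
apply: eq_bigr => a _; rewrite -sum1_card big_mkcond [RHS]big_mkcond.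
by apply: eq_bigr => b _; rewrite inE; case: (b \in B) => //=; case: ltnP.
Qed.

Lemma ninvUl A B C : [disjoint A & B] -> ninv (A :|: B) C = (ninv A C + ninv B C)%N.
Proof. by move=> dAB; rewrite /ninv -bigU //; apply: eq_bigl => a; rewrite !inE. Qed.

Lemma ninvUr A B C : [disjoint B & C] -> ninv A (B :|: C) = (ninv A B + ninv A C)%N.
Proof.
move=> dBC; rewrite !ninvE -big_split; apply: eq_bigr => a _.
by rewrite -bigU //; apply: eq_bigl => b; rewrite !inE.
Qed.

(** Each pair of generators is inverted in exactly one of the two orders; disjointness excludes
    equal generators. *)
Lemma ninv_sym A B : [disjoint A & B] -> (ninv A B + ninv B A = #|A| * #|B|)%N.
Proof.
move=> dAB; rewrite !ninvE [X in (_ + X)%N]exchange_big -big_split /=.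
rewrite -sum_nat_const; apply: eq_bigr => a aA; rewrite -big_split -sum1_card /=.
apply: eq_bigr => b bB; case: ltngtP => //= ab.
by move/ord_inj: ab bB => ->; rewrite (disjointFr dAB aA).
Qed.

End Signs.

(** * Grassmann algebras *)

Definition grass (n : nat) := Mon n -> R.

Section Grassmann.
Variable n : nat.
Implicit Types (u v w : grass n) (A B C S T : Mon n).

HB.instance Definition _ := gen_eqMixin (grass n).
HB.instance Definition _ := gen_choiceMixin (grass n).

Definition gadd u v : grass n := fun S => u S + v S.
Definition gopp u : grass n := fun S => - u S.
Definition gzero : grass n := fun S => 0.
Definition gone : grass n := fun S => (S == set0)%:R.
Definition gscale (c : R) u : grass n := fun S => c * u S.
Definition gmul u v : grass n := fun S =>
  \sum_(A : Mon n | A \subset S) (-1) ^+ ninv A (S :\: A) * u A * v (S :\: A).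

Fact gaddA : associative gadd.
Proof. by move=> u v w; apply/funext => S; apply: addrA. Qed.
Fact gaddC : commutative gadd.
Proof. by move=> u v; apply/funext => S; apply: addrC. Qed.
Fact gadd0 : left_id gzero gadd.
Proof. by move=> u; apply/funext => S; apply: add0r. Qed.
Fact gaddN : left_inverse gzero gopp gadd.
Proof. by move=> u; apply/funext => S; apply: addNr. Qed.

HB.instance Definition _ := GRing.isZmodule.Build (grass n) gaddA gaddC gadd0 gaddN.

Lemma setU_setD A T : A \subset T -> A :|: (T :\: A) = T.
Proof. by move=> /setUidPr {2}<-; apply/setP => x; rewrite !inE; case: (x \in A). Qed.

Lemma gmul_reindex S A (f : Mon n -> Mon n -> R) : A \subset S ->
  \sum_(T : Mon n | (T \subset S) && (A \subset T)) f T (T :\: A) =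
  \sum_(B : Mon n | B \subset S :\: A) f (A :|: B) B.
Proof.
move=> AS; rewrite (reindex_onto (fun B => A :|: B) (fun T => T :\: A)); last first.
  by move=> T /andP[_ AT]; apply: setU_setD.
apply: eq_big => B.
  rewrite subUset AS subsetUl andbT /= setDUl setDv set0U subsetD.
  by congr (_ && _); apply/eqP/idP => [/setDidPl // | /setDidPl].
by move=> /andP[_ /eqP ->].
Qed.

(** Both sides are sums over ordered partitions of [S] into [A], [B], [C]; the signs agree because
    the inversion number is additive in each argument. *)
Fact gmulA : associative gmul.
Proof.
move=> u v w; apply/funext => S; rewrite /gmul.
under eq_bigr do rewrite mulr_sumr.
under [RHS]eq_bigr do rewrite mulr_sumr mulr_suml.
rewrite [RHS](exchange_big_dep (fun A => A \subset S)) /=; last first.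
  by move=> T A TS AT; apply: subset_trans TS.
apply: eq_bigr => A AS.
rewrite (gmul_reindex S A (fun T B => (-1) ^+ ninv T (S :\: T) *
  ((-1) ^+ ninv A B * u A * v B) * w (S :\: T))) //.
apply: eq_bigr => B; rewrite subsetD disjoint_sym => /andP[BS dAB].
rewrite setDDl; set C := S :\: (A :|: B).
have dABC : [disjoint A :|: B & C] by rewrite disjoints_subset /C setDE setCI setCK subsetUr.
have /andP[dAC dBC] : [disjoint A & C] && [disjoint B & C].
  by move: dABC; rewrite !(disjoint_sym _ C) !disjoints_subset setCU subsetI.
have -> : S :\: A = B :|: C.
  by rewrite /C -setDDl setU_setD // subsetD BS disjoint_sym.
rewrite ninvUl // ninvUr // !exprD.
ringR.
Qed.

Fact gmul1l : left_id gone gmul.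
Proof.
move=> u; apply/funext => S; rewrite /gmul (bigD1 set0) ?sub0set //= big1 ?addr0.
  by rewrite /gone eqxx setD0 /ninv big_set0 expr0 !mul1r.
by move=> A /andP[_ /negPf nA]; rewrite /gone nA mulr0 mul0r.
Qed.

Fact gmul1r : right_id gone gmul.
Proof.
move=> u; apply/funext => S; rewrite /gmul (bigD1 S) //= big1 ?addr0.
  rewrite /gone setDv eqxx mulr1 ninvE exchange_big big_set0 expr0 ?mul1r //.
move=> A /andP[AS nA]; rewrite /gone.
case: eqP => [SA|_]; last by rewrite mulr0.
by case/negP: nA; rewrite eqEsubset AS -setD_eq0 SA eqxx.
Qed.

Fact gmulDl : left_distributive gmul gadd.
Proof.
move=> u v w; apply/funext => S; rewrite /gmul /gadd -big_split.
by apply: eq_bigr => A _; rewrite mulrDr mulrDl.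
Qed.

Fact gmulDr : right_distributive gmul gadd.
Proof.
move=> u v w; apply/funext => S; rewrite /gmul /gadd -big_split.
by apply: eq_bigr => A _; rewrite mulrDr.
Qed.

Fact gone_neq0 : gone != gzero.
Proof.
apply/eqP => /(congr1 (fun u => u set0)) /eqP.
by rewrite /gone /gzero eqxx oner_eq0.
Qed.

HB.instance Definition _ := GRing.Zmodule_isNzRing.Build (grass n)
  gmulA gmul1l gmul1r gmulDl gmulDr gone_neq0.

Fact gscaleA (a b : R) u : gscale a (gscale b u) = gscale (a * b) u.
Proof. by apply/funext => S; apply: mulrA. Qed.
Fact gscale1 : left_id 1 gscale.
Proof. by move=> u; apply/funext => S; apply: mul1r. Qed.
Fact gscaleDr : right_distributive gscale +%R.
Proof. by move=> a u v; apply/funext => S; apply: mulrDr. Qed.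
Fact gscaleDl u : {morph gscale^~ u : a b / a + b}.
Proof. by move=> a b; apply/funext => S; apply: mulrDl. Qed.

HB.instance Definition _ := GRing.Zmodule_isLmodule.Build R (grass n)
  gscaleA gscale1 gscaleDr gscaleDl.

Fact gscaleAl (a : R) u v : a *: (u * v) = (a *: u) * v.
Proof.
apply/funext => S; rewrite [LHS]mulr_sumr; apply: eq_bigr => A _.
rewrite -[(a *: u) _]/(a * u A); ringR.
Qed.
HB.instance Definition _ := GRing.Lmodule_isLalgebra.Build R (grass n) gscaleAl.

Fact gscaleAr (a : R) u v : a *: (u * v) = u * (a *: v).
Proof.
apply/funext => S; rewrite [LHS]mulr_sumr; apply: eq_bigr => A _.
rewrite -[(a *: v) _]/(a * v (S :\: A)); ringR.
Qed.
HB.instance Definition _ := GRing.Lalgebra_isAlgebra.Build R (grass n) gscaleAr.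

Lemma gaddE u v S : (u + v) S = u S + v S. Proof. by []. Qed.
Lemma goppE u S : (- u) S = - u S. Proof. by []. Qed.
Lemma gscaleE (c : R) u S : (c *: u) S = c * u S. Proof. by []. Qed.
Lemma goneE S : (1 : grass n) S = (S == set0)%:R. Proof. by []. Qed.
Lemma gmulE u v S : (u * v) S =
  \sum_(A : Mon n | A \subset S) (-1) ^+ ninv A (S :\: A) * u A * v (S :\: A).
Proof. by []. Qed.

Lemma gsumE (I : Type) (r : seq I) (P : pred I) (f : I -> grass n) S :
  (\sum_(i <- r | P i) f i) S = \sum_(i <- r | P i) f i S.
Proof. by apply: (big_morph (fun u : grass n => u S)). Qed.

Definition gdeg (p : nat) u := forall S, #|S| != p -> u S = 0.

Lemma gdegM p q u v : gdeg p u -> gdeg q v -> gdeg (p + q)%N (u * v).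
Proof.
move=> du dv S; rewrite gmulE => cS; apply: big1 => A AS.
have cA : (#|A| + #|S :\: A| = #|S|)%N by rewrite -[in RHS](setU_setD _ _ AS) cardsU setIDA setDIl setDv set0I cards0 subn0.
have [Ap|nAp] := eqVneq #|A| p; last by rewrite du // mulr0 mul0r.
by rewrite dv ?mulr0 //; apply: contraNneq cS => Bq; rewrite -cA Ap Bq.
Qed.

Lemma gdeg1 : gdeg 0 1.
Proof. by move=> S; rewrite goneE cards_eq0 => /negPf ->. Qed.

Lemma gdegX p u k : gdeg p u -> gdeg (p * k)%N (u ^+ k).
Proof.
move=> du; elim: k => [|k IH]; first by rewrite muln0 expr0; apply: gdeg1.
by rewrite exprS mulnS; apply: gdegM.
Qed.

Lemma gdegN p u : gdeg p u -> gdeg p (- u).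
Proof. by move=> du S cS; rewrite goppE du ?oppr0. Qed.

Lemma gdeg_sum p (I : Type) (r : seq I) (P : pred I) (f : I -> grass n) :
  (forall i, P i -> gdeg p (f i)) -> gdeg p (\sum_(i <- r | P i) f i).
Proof. by move=> df S cS; rewrite gsumE big1 // => i Pi; apply: df. Qed.

(** The source of nilpotency: in degree [2(n+1)] it kills a power of [theta^2], in degree [2n+1] the
    product of a generator with [theta^(2n)]. *)
Lemma gdeg_big p u : gdeg p u -> (2 * n < p)%N -> u = 0.
Proof.
move=> du np; apply/funext => S; apply: du; rewrite neq_ltn.
by rewrite (leq_ltn_trans (max_card _)) // card_ord.
Qed.

Definition geven u := forall S, odd #|S| -> u S = 0.
(** The grading involution, which is [sf_inv] at a point; it is the twist in the Leibniz rule and in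
    commuting with odd elements. *)
Definition gpar u : grass n := fun S => (-1) ^+ #|S| * u S.

Lemma geven_deg p u : ~~ odd p -> gdeg p u -> geven u.
Proof. by move=> op du S oS; apply: du; apply: contraTneq oS => ->. Qed.

Lemma gmul_rev u v S : (u * v) S =
  \sum_(A : Mon n | A \subset S) (-1) ^+ ninv (S :\: A) A * u (S :\: A) * v A.
Proof.
rewrite gmulE (reindex_onto (fun A => S :\: A) (fun A => S :\: A)) /=; last first.
  by move=> A AS; rewrite setDDr setDv set0U; apply/setIidPr.
rewrite (eq_bigl (fun A => A \subset S)); last first.
  by move=> A; rewrite subsetDl setDDr setDv set0U; apply/eqP/idP => /setIidPr.
by apply: eq_bigr => A AS; rewrite setDDr setDv set0U; have /setIidPr -> := AS.
Qed.

Lemma sign_ninv_swap A B : [disjoint A & B] ->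
  (-1) ^+ ninv B A = (-1) ^+ (#|A| * #|B|) * (-1) ^+ ninv A B :> R.
Proof. by move=> d; rewrite -ninv_sym // exprD mulrAC -expr2 sqrr_sign mul1r. Qed.

Lemma disjointD A S : [disjoint A & S :\: A].
Proof. by rewrite disjoint_sym disjoints_subset setDE subsetIr. Qed.

(** Exchanging disjoint monomials costs [(-1)^(|A| |B|)], which is 1 when [|A|] is even. *)
Lemma gevenC u v : geven u -> u * v = v * u.
Proof.
move=> eu; apply/funext => S; rewrite gmulE gmul_rev; apply: eq_bigr => A AS.
have [oA|eA] := boolP (odd #|A|); first by rewrite eu // !mulr0 mul0r.
by rewrite (sign_ninv_swap _ _ (disjointD A S)) -(signr_odd _ (#|A| * _)) oddM (negPf eA) mul1r mulrAC.
Qed.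

Definition godd u := forall S, ~~ odd #|S| -> u S = 0.

(** For odd [|A|] the exchange sign is [(-1)^|B|], the factor by which [gpar] acts on a monomial. *)
Lemma goddC u v : godd u -> u * v = gpar v * u.
Proof.
move=> ou; apply/funext => S; rewrite gmulE gmul_rev; apply: eq_bigr => A AS.
have [oA|eA] := boolP (odd #|A|); last by rewrite ou // !mulr0 mul0r.
rewrite (sign_ninv_swap _ _ (disjointD A S)) -(signr_odd _ (#|A| * _)) oddM oA signr_odd /gpar.
set t := (-1) ^+ #|_|; have tt : t * t = 1 by rewrite /t -expr2 sqrr_sign.
by rewrite -[LHS]mul1r -tt; ringR.
Qed.

Lemma godd_deg p u : odd p -> gdeg p u -> godd u.
Proof. by move=> op du S oS; apply: du; apply: contraNneq oS => ->. Qed.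

Lemma gparD u v : gpar (u + v) = gpar u + gpar v.
Proof. by apply/funext => S; rewrite /gpar gaddE mulrDr. Qed.

Lemma gparN u : gpar (- u) = - gpar u.
Proof. by apply/funext => S; rewrite /gpar !goppE mulrN. Qed.

Lemma gparZ (c : R) u : gpar (c *: u) = c *: gpar u.
Proof. by apply/funext => S; rewrite /gpar !gscaleE /gpar mulrCA. Qed.

Lemma gpar_even u : geven u -> gpar u = u.
Proof.
move=> eu; apply/funext => S; rewrite /gpar -signr_odd.
by have [/eu ->|_] := boolP (odd #|S|); rewrite ?mulr0 ?mul1r.
Qed.

Lemma gpar_odd u : godd u -> gpar u = - u.
Proof.
move=> ou; apply/funext => S; rewrite /gpar -signr_odd goppE.
by have [_|/ou ->] := boolP (odd #|S|); rewrite ?mulr0 ?oppr0 ?expr1 ?mulN1r.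
Qed.

Lemma godd_anti u v : godd u -> godd v -> u * v = - (v * u).
Proof. by move=> ou ov; rewrite goddC // gpar_odd // mulNr. Qed.

(** * Left derivatives in odd directions *)

Section OddDerivative.
Variable a : 'I_(2 * n).
Notation lt_a S := #|[set i in S | (i < a)%N]|.

Definition gder u : grass n := fun S =>
  if a \in S then 0 else (-1) ^+ lt_a S * u (a |: S).

Lemma big_subset_setU1 S (f : Mon n -> R) : a \notin S ->
  \sum_(A : Mon n | A \subset a |: S) f A =
  \sum_(A : Mon n | A \subset S) (f A + f (a |: A)).
Proof.
move=> aS; rewrite (bigID (fun A : Mon n => a \in A)) /= addrC big_split; congr (_ + _).
  apply: eq_bigl => A; rewrite -subsetD1 setU1K //.
rewrite (reindex_onto (fun A => a |: A) (fun A => A :\ a)) /=; last first.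
  by move=> A /andP[_ aA]; rewrite setD1K.
apply: eq_bigl => A; rewrite setU11 andbT; apply/andP/idP => [[AS /eqP <-]|AS].
  by rewrite -(setU1K aS) setSD.
have aA : a \notin A by apply: contra aS; apply: (subsetP AS).
by rewrite setU1K // eqxx setUS.
Qed.

Notation l A := (ninv [set a] A).

Lemma lt_ninv A : lt_a A = l A.
Proof. by rewrite /ninv big_set1. Qed.

Lemma sign_ninv1 A : a \notin A -> (-1) ^+ ninv A [set a] = (-1) ^+ #|A| * (-1) ^+ l A :> R.
Proof.
by move=> aA; rewrite sign_ninv_swap ?disjoints1 // cards1 mul1n.
Qed.

Lemma gmul_setU1 u v S : a \notin S -> (u * v) (a |: S) =
  \sum_(A : Mon n | A \subset S) (-1) ^+ ninv A (S :\: A) *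
     ((-1) ^+ #|A| * (-1) ^+ l A * u A * v (a |: (S :\: A)) +
      (-1) ^+ l (S :\: A) * u (a |: A) * v (S :\: A)).
Proof.
move=> aS; rewrite gmulE big_subset_setU1 //; apply: eq_bigr => A AS.
have aA : a \notin A by apply: contra aS; apply: (subsetP AS).
have aB : a \notin S :\: A by rewrite inE (negPf aS) andbF.
have -> : (a |: S) :\: A = a |: (S :\: A).
  by rewrite setDUl; congr (_ :|: _); apply/setDidPl; rewrite disjoints1.
have -> : (a |: S) :\: (a |: A) = S :\: A by rewrite -setDDl setU1K.
rewrite ninvUr ?disjoints1 // ninvUl ?disjoints1 // !exprD sign_ninv1 //.
ringR.
Qed.

Lemma signK k : (-1) ^+ k * (-1) ^+ k = 1 :> R.
Proof. by rewrite -expr2 sqrr_sign. Qed.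

Lemma gderM u v : gder (u * v) = gder u * v + gpar u * gder v.
Proof.
apply/funext => S; rewrite gaddE {1}/gder; case: ifP => [aS|/negbT aS].
  (* A derivative has no monomial containing [a]. On the right, for each splitting of the remaining
     generators, the two contributions differ by a sign and cancel. *)
  rewrite -(setD1K aS); set T := S :\ a.
  have aT : a \notin T by rewrite !inE eqxx.
  rewrite !gmul_setU1 // -big_split; symmetry; apply: big1 => A AT.
  have aA : a \notin A by apply: contra aT; apply: (subsetP AT).
  have aB : a \notin T :\: A by rewrite inE (negPf aT) andbF.
  rewrite /gder /gpar !setU11 (negPf aA) (negPf aB) !lt_ninv cardsU1 aA /= exprD expr1.
  have := signK (l A); have := signK (l (T :\: A)).
  move: ((-1) ^+ l A) ((-1) ^+ l (T :\: A)) ((-1) ^+ #|A|) => x y z.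
  move=> yy xx.
  transitivity ((-1) ^+ ninv A (T :\: A) * z * u (a |: A) * v (a |: (T :\: A)) * (x * x - y * y))%R; last by rewrite xx yy; ringR.
  ringR.
(* Here [a] joins either the left or the right factor of each splitting, which gives the two terms
   of the rule. *)
rewrite gmul_setU1 // mulr_sumr !gmulE -big_split; apply: eq_bigr => A AS.
have aA : a \notin A by apply: contra aS; apply: (subsetP AS).
have aB : a \notin S :\: A by rewrite inE (negPf aS) andbF.
rewrite /gder /gpar (negPf aA) (negPf aB) !lt_ninv.
rewrite -[in l S](setU_setD _ _ AS) ninvUr ?disjointD // exprD.
have := signK (l A); have := signK (l (S :\: A)).
move: ((-1) ^+ l A) ((-1) ^+ l (S :\: A)) ((-1) ^+ #|A|) => x y z.
move=> yy xx.
set e := (-1) ^+ _.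
transitivity (e * (z * (x * x) * y * u A * v (a |: (S :\: A)) + x * (y * y) * u (a |: A) * v (S :\: A)))%R; first ringR.
by rewrite xx yy /=; ringR.
Qed.

End OddDerivative.
End Grassmann.

(** * Superfunctions evaluated at a point *)

Section Evaluation.
Variable n : nat.
Implicit Types (F G : SF n) (x : Pt) (u v : grass n).

(** Algebra passes through [ev], but differentiation in the even coordinates does not; sequences of
    iterated derivatives take over there. *)
Definition ev x F : grass n := fun S => F S x.

Lemma ev_add x F G : ev x (sf_add F G) = ev x F + ev x G. Proof. by []. Qed.
Lemma ev_opp x F : ev x (sf_opp F) = - ev x F. Proof. by []. Qed.
Lemma ev_scal x (c : R) F : ev x (sf_scal c F) = c *: ev x F. Proof. by []. Qed.
Lemma ev_zero x : ev x (sf_zero n) = 0. Proof. by []. Qed.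

Lemma ev_mul x F G : ev x (sf_mul F G) = ev x F * ev x G.
Proof.
apply/funext => S; rewrite gmulE; apply: eq_big => A; first by rewrite powersetE.
by move=> _; rewrite RpowE.
Qed.

Lemma ev_big x (I : Type) (r : seq I) (P : pred I) (f : I -> SF n) :
  ev x (\big[@sf_add n/sf_zero n]_(i <- r | P i) f i) = \sum_(i <- r | P i) ev x (f i).
Proof. by apply: (big_morph (ev x)). Qed.

Lemma ev_sum x k0 k1 (f : nat -> SF n) :
  ev x (sf_sum k0 k1 f) = \sum_(k0 <= k < k1) ev x (f k).
Proof. exact: ev_big. Qed.

Lemma ev_ev x f : ev x (sf_ev n f) = f x *: 1.
Proof.
apply/funext => S; rewrite gscaleE goneE /ev /sf_ev.
by case: ifP => _; rewrite ?mulr1 ?mulr0.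
Qed.

Lemma ev_const x (c : R) : ev x (sf_const n c) = c *: 1.
Proof. exact: ev_ev. Qed.

Lemma ev_pow x F k : ev x (sf_pow F k) = ev x F ^+ k.
Proof.
elim: k => [|k IH] /=; first by rewrite ev_const scale1r.
by rewrite ev_mul IH exprS.
Qed.

Lemma ev_inv x F : ev x (sf_inv F) = gpar _ (ev x F).
Proof.
apply/funext => S; rewrite /ev /sf_inv /gpar -signr_odd.
by case: odd; rewrite ?mulN1r ?mul1r.
Qed.

Definition gy (a : nat) : grass n := ev (fun _ => 0) (sf_gen n a).
Definition gth : grass n := - \sum_(p < n) gy (2 * p) * gy (2 * p).+1.
(** The odd derivative acts on monomials only, so constant coefficients suffice to compute it.
    Unlike [gder] it takes a natural number, with value 0 out of range. *)
Definition gdo (a : nat) u : grass n := ev (fun _ => 0) (sf_dodd a (fun S _ => u S)).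

Lemma ev_gen x a : ev x (sf_gen n a) = gy a. Proof. by []. Qed.

Lemma ev_theta2 x : ev x (theta2 n) = gth.
Proof.
rewrite /theta2 ev_opp ev_big; congr (- _); apply: eq_bigr => p _.
by rewrite ev_mul !ev_gen.
Qed.

Lemma oddsetE (a : 'I_(2 * n)) : oddset n a = [set a].
Proof. by apply/setP => i; rewrite !inE -val_eqE. Qed.

Lemma gdo_gder (a : 'I_(2 * n)) u : gdo a u = gder _ a u.
Proof.
apply/funext => S; rewrite /gdo /ev /sf_dodd ltn_ord /= oddsetE /gder.
rewrite setI_eq0 disjoint_sym disjoints1 -RmultE setUC RpowE.
by case: (a \in S).
Qed.

Lemma gdoD a u v : gdo a (u + v) = gdo a u + gdo a v.
Proof.
by apply/funext => S; rewrite gaddE /gdo /ev /sf_dodd; case: ifP; rewrite ?addr0 // !RmultE gaddE mulrDr.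
Qed.

Lemma gdoZ a (c : R) u : gdo a (c *: u) = c *: gdo a u.
Proof.
by apply/funext => S; rewrite gscaleE /gdo /ev /sf_dodd; case: ifP; rewrite ?mulr0 // !RmultE gscaleE mulrCA.
Qed.

Lemma gdoM a u v : (a < 2 * n)%N -> gdo a (u * v) = gdo a u * v + gpar _ u * gdo a v.
Proof. by move=> an; rewrite !(gdo_gder (Ordinal an)) gderM. Qed.

Lemma gdeg_gy a : gdeg _ 1 (gy a).
Proof.
move=> S cS; rewrite /gy /ev /sf_gen; case: (ltnP a (2 * n)) => //= an.
rewrite (oddsetE (Ordinal an)); case: eqP => // SE.
by rewrite SE cards1 in cS.
Qed.

Lemma gdo_gy a b : (a < 2 * n)%N -> gdo a (gy b) = (a == b)%:R.
Proof.
move=> an; rewrite (gdo_gder (Ordinal an)); apply/funext => S; rewrite /gder.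
have -> : ((a == b)%:R : grass n) S = ((a == b) && (S == set0))%:R :> R.
  by case: (a == b); rewrite ?goneE.
case: ifP => [aS|/negbT aS].
  by rewrite [S == set0](introF eqP) ?andbF // => S0; rewrite S0 inE in aS.
rewrite /gy /ev /sf_gen; case: (ltnP b (2 * n)) => /= bn; last first.
  by rewrite (introF eqP) ?mulr0 // => ab; move: bn; rewrite -ab leqNgt an.
rewrite (oddsetE (Ordinal bn)).
case: (eqVneq a b) => [ab|ab] /=; last first.
  rewrite ifN ?mulr0 //; apply: contra ab => /eqP /setP /(_ (Ordinal an)).
  by rewrite !inE eqxx /= -val_eqE /= eq_sym => /esym.
have -> : Ordinal bn = Ordinal an by apply: val_inj.
case: (eqVneq S set0) => [->|S0].
  rewrite setU0 eqxx mulr1 [X in (-1) ^+ X](_ : _ = 0%N) //; apply: eq_card0 => i.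
  by rewrite !inE.
rewrite ifN ?mulr0 //; apply: contra S0 => /eqP SE.
by rewrite -(setU1K aS) SE setDv.
Qed.

(* [d_{y^b}], with 1-based [b] *)
Definition gup (b : nat) u : grass n :=
  if odd b then IZR 2 *: gdo b u else IZR (-2) *: gdo b.-2 u.

Lemma gupD b u v : gup b (u + v) = gup b u + gup b v.
Proof. by rewrite /gup; case: ifP => _; rewrite gdoD scalerDr. Qed.

Lemma gupZ b (c : R) u : gup b (c *: u) = c *: gup b u.
Proof. by rewrite /gup; case: ifP => _; rewrite gdoZ !scalerA mulrC. Qed.

Lemma gup_sum b (I : Type) (r : seq I) (P : pred I) (f : I -> grass n) :
  gup b (\sum_(i <- r | P i) f i) = \sum_(i <- r | P i) gup b (f i).
Proof.
have gup0 : gup b 0 = 0 by have := gupZ b 0 0; rewrite !scale0r.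
exact: (big_morph (gup b) (gupD b) gup0).
Qed.

Lemma gupM b u v : (1 <= b <= 2 * n)%N ->
  gup b (u * v) = gup b u * v + gpar _ u * gup b v.
Proof.
move=> bn; rewrite /gup; case: ifP => ob; (rewrite gdoM; last by lia); by rewrite scalerDr scalerAl scalerAr.
Qed.

Lemma gth_deg : gdeg _ 2 gth.
Proof.
by apply: gdegN; apply: gdeg_sum => p _; apply: (gdegM _ 1 1); apply: gdeg_gy.
Qed.

Lemma gth_even k : geven _ (gth ^+ k).
Proof.
by apply: (geven_deg _ (2 * k)); [rewrite oddM | apply: gdegX; apply: gth_deg].
Qed.

Lemma gthX_gt k : (n < k)%N -> gth ^+ k = 0.
Proof. by move=> nk; apply: (gdeg_big _ (2 * k)); [apply: gdegX; apply: gth_deg | rewrite ltn_mul2l]. Qed.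

Lemma gy_odd a : godd _ (gy a).
Proof. exact: godd_deg (gdeg_gy a). Qed.

(** Exactly one pair in [theta^2] contains the differentiated generator. For odd [b] it is the
    second factor, and passing the first one cancels the minus sign of [theta^2]; for even [b] it is
    the first factor, and the minus sign cancels against the -2 in [gup]. *)
Lemma gup_gth b : (1 <= b <= 2 * n)%N -> gup b gth = IZR 2 *: gy b.-1.
Proof.
move=> bn.
have gdoN a : gdo a gth = - \sum_(p < n) gdo a (gy (2 * p) * gy (2 * p).+1).
  rewrite /gth -scaleN1r gdoZ scaleN1r; congr (- _).
  have gdo0 : gdo a 0 = 0 by have := gdoZ a 0 0; rewrite !scale0r.
  exact: (big_morph (gdo a) (gdoD a) gdo0).
rewrite /gup; case: ifP => ob; rewrite gdoN; last first.
  have pn : (b.-2./2 < n)%N by lia.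
  rewrite (bigD1 (Ordinal pn)) //= big1 ?addr0.
    rewrite gdoM; last by lia.
    rewrite !gdo_gy; try lia.
    have -> : (2 * b.-2./2 = b.-2)%N by lia.
    have -> : (b.-2.+1 = b.-1)%N by lia.
    rewrite eqxx [_ == _](introF eqP) ?mulr0 ?addr0 ?mul1r; last by lia.
    by rewrite scalerN -scaleNr -RoppE -opp_IZR.
  move=> p /eqP pb; rewrite gdoM; last by lia.
  rewrite !gdo_gy; try lia.
  rewrite [_ == _](introF eqP) ?[_ == (2 * p).+1](introF eqP) ?mulr0 ?mul0r ?addr0 //; first by lia.
  by move=> h; apply: pb; apply: val_inj => /=; lia.
have pn : (b./2 < n)%N by lia.
rewrite (bigD1 (Ordinal pn)) //= big1 ?addr0.
  rewrite gdoM; last by lia.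
  rewrite !gdo_gy; try lia.
  have -> : (2 * b./2 = b.-1)%N by lia.
  have -> : (b.-1.+1 = b)%N by lia.
  rewrite eqxx [_ == _](introF eqP) ?mul0r ?add0r ?mulr1; last by lia.
  by rewrite gpar_odd ?opprK //; apply: gy_odd.
move=> p /eqP pb; rewrite gdoM; last by lia.
rewrite !gdo_gy; try lia.
rewrite [_ == _](introF eqP) ?[_ == (2 * p).+1](introF eqP) ?mulr0 ?mul0r ?addr0 //; last by lia.
by move=> h; apply: pb; apply: val_inj => /=; lia.
Qed.

Lemma gup_gthX b k : (1 <= b <= 2 * n)%N ->
  gup b (gth ^+ k.+1) = k.+1%:R *: (IZR 2 *: (gy b.-1 * gth ^+ k)).
Proof.
move=> bn; elim: k => [|k IH]; first by rewrite expr1 expr0 mulr1 scale1r gup_gth.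
rewrite exprS gupM // gup_gth // IH gpar_even; last by rewrite -[gth]expr1; apply: gth_even.
rewrite -!scalerAr mulrA (gevenC _ gth); last by rewrite -[gth]expr1; apply: gth_even.
rewrite -mulrA -exprS -scalerAl -[in RHS]natr1 addrC.
by rewrite [RHS]scalerDl scale1r.
Qed.

(** * The exponential of [- theta^2 E] on formal jets *)

Definition pcoef (j : nat) := (-1) ^+ j / (j`!%:R : R).

Lemma pcoef0 : pcoef 0 = 1.
Proof. by rewrite /pcoef expr0 fact0 divr1. Qed.

(** An arbitrary sequence [v] stands for the jet, so that the algebraic laws of the projection
    require no smoothness. *)
Definition gphi (v : nat -> grass n) : grass n :=
  \sum_(j < n.+1) pcoef j *: (gth ^+ j * v j).

Lemma eq_gphi (v w : nat -> grass n) : (forall j, v j = w j) -> gphi v = gphi w.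
Proof. by move=> vw; apply: eq_bigr => j _; rewrite vw. Qed.

Lemma gphiD (v w : nat -> grass n) : gphi (fun j => v j + w j) = gphi v + gphi w.
Proof. by rewrite -big_split; apply: eq_bigr => j _; rewrite mulrDr scalerDr. Qed.

Lemma gphiZ (c : R) (v : nat -> grass n) : gphi (fun j => c *: v j) = c *: gphi v.
Proof.
by rewrite scaler_sumr; apply: eq_bigr => j _; rewrite -scalerAr !scalerA mulrC.
Qed.

Lemma gphi_mull u (v : nat -> grass n) : gphi (fun j => u * v j) = u * gphi v.
Proof.
rewrite mulr_sumr; apply: eq_bigr => j _.
by rewrite -scalerAr !mulrA (gevenC _ _ u) //; apply: gth_even.
Qed.

Lemma gphi_const (v : nat -> grass n) : (forall j, v j.+1 = 0) -> gphi v = v 0%N.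
Proof.
move=> v0; rewrite /gphi big_ord_recl big1 ?addr0 => [|j _].
  by rewrite pcoef0 expr0 mul1r scale1r.
by rewrite v0 mulr0 scaler0.
Qed.

(** The law of exponential coefficients, which turns the Leibniz rule into a product of series. *)
Lemma pcoefM a b : pcoef (a + b) * 'C(a + b, a)%:R = pcoef a * pcoef b.
Proof.
have nz k : k`!%:R != 0 :> R by rewrite -INRE; apply/eqP; apply: not_0_INR; have := fact_gt0 k; lia.
have NE : (a + b)`!%:R = 'C(a + b, a)%:R * a`!%:R * b`!%:R :> R.
  by rewrite -(bin_fact (leq_addr b a)) addKn !natrM mulrA.
have Cnz : 'C(a + b, a)%:R != 0 :> R.
  by move: (nz (a + b)%N); rewrite NE !mulf_eq0 !negb_or => /andP[/andP[]].
rewrite /pcoef exprD NE.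
move: (nz a) (nz b) Cnz => /eqP ha /eqP hb /eqP hC.
exact: Rmult_div_split.
Qed.

Lemma pcoefS j : pcoef j.+1 * j.+1%:R = - pcoef j.
Proof.
have := pcoefM j 1; rewrite addn1 binSn => ->.
by rewrite /pcoef expr1 divr1 mulrN1.
Qed.

(** Cauchy product: the triangle is completed to a square by terms that vanish. *)
Lemma big_triangle (V : zmodType) N (t : nat -> nat -> V) :
  (forall a b, (N <= a + b)%N -> t a b = 0) ->
  \sum_(j < N) \sum_(a < j.+1) t a (j - a)%N = \sum_(a < N) \sum_(b < N) t a b.
Proof.
move=> t0.
under eq_bigr => j _ do rewrite (big_ord_widen N (fun a => t a (j - a)%N)) //.
rewrite (exchange_big_dep predT) //=; apply: eq_bigr => a _.
rewrite -(big_mkord (fun j => (a < j.+1)%N) (fun j => t a (j - a)%N)).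
rewrite -(big_mkord predT (fun b => t a b)).
rewrite [RHS](@big_cat_nat _ _ _ (N - a)) ?leq_subr //= [X in _ = _ + X]big1_seq ?addr0; last first.
  by move=> b; rewrite mem_index_iota => hb; apply: t0; lia.
rewrite [LHS](@big_cat_nat _ _ _ a) ?(ltnW (ltn_ord a)) //= [X in X + _ = _]big1_seq ?add0r; last first.
  by move=> j; rewrite mem_index_iota; lia.
rewrite -{1}[nat_of_ord a]add0n big_addn; apply: eq_big => [j|j _]; first lia.
by rewrite addnK.
Qed.

(** The hypothesis is the Leibniz rule for a scalar function with jet [s] times a superfunction with
    jet [v]. The terms with [a + b > n] vanish by nilpotency of [theta^2]. *)
Lemma gphi_mul (s : nat -> R) (v w : nat -> grass n) :
  (forall j, w j = \sum_(a < j.+1) ('C(j, a)%:R * s a) *: v (j - a)%N) ->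
  gphi w = gphi (fun j => s j *: 1) * gphi v.
Proof.
move=> wE.
pose t a b : grass n := (pcoef a * pcoef b * s a) *: (gth ^+ (a + b) * v b).
transitivity (\sum_(a < n.+1) \sum_(b < n.+1) t a b).
  rewrite -big_triangle; last by move=> a b ab; rewrite /t gthX_gt // mul0r scaler0.
  apply: eq_bigr => j _; rewrite wE mulr_sumr scaler_sumr; apply: eq_bigr => a _.
  rewrite -scalerAr scalerA /t -pcoefM subnKC -1?ltnS // ; congr (_ *: _).
  by rewrite mulrA.
rewrite mulr_suml; apply: eq_bigr => a _; rewrite mulr_sumr; apply: eq_bigr => b _.
rewrite /t exprD -!scalerAr -!scalerAl !scalerA mulr1 mulrA; congr (_ *: _).
  by rewrite (mulrC (pcoef a)).
by rewrite mulrA.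
Qed.

(* The top term [gy * gth ^+ n] created by the shift vanishes for degree reasons. *)
Lemma gphi_up b (v : nat -> grass n) : (1 <= b <= 2 * n)%N ->
  gup b (gphi v) = gphi (fun j => gup b (v j)) - IZR 2 *: (gy b.-1 * gphi (fun j => v j.+1)).
Proof.
move=> bn; rewrite /gphi gup_sum.
have E j : gup b (pcoef j *: (gth ^+ j * v j)) =
    pcoef j *: (gup b (gth ^+ j) * v j) + pcoef j *: (gth ^+ j * gup b (v j)).
  by rewrite gupZ gupM // gpar_even ?scalerDr //; apply: gth_even.
rewrite (eq_bigr _ (fun (j : 'I_n.+1) _ => E j)).
rewrite big_split /= addrC; congr (_ + _).
rewrite big_ord_recl expr0 (_ : gup b 1 = 0) ?mul0r ?scaler0 ?add0r; last first.
  have := gupM b 1 1 bn; rewrite !mulr1 gpar_even ?mul1r; last by rewrite -(expr0 gth); apply: gth_even.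
  by rewrite -[X in X = _ -> _]addr0 => /addrI.
rewrite mulr_sumr big_ord_recr /=.
have -> : gy b.-1 * (pcoef n *: (gth ^+ n * v n.+1)) = 0.
  rewrite -scalerAr mulrA (_ : gy b.-1 * gth ^+ n = 0) ?mul0r ?scaler0 //.
  apply: (gdeg_big _ (1 + 2 * n)) => //; apply: gdegM; first exact: gdeg_gy.
  by apply: gdegX; apply: gth_deg.
rewrite addr0 scaler_sumr -sumrN; apply: eq_bigr => j _.
(* The exponent brought down by the derivative is absorbed by [pcoefS], which also produces the
   minus sign. *)
rewrite /bump leq0n add1n gup_gthX // -!scalerAl -!scalerAr !scalerA -scaleNr; congr (_ *: _).
  by rewrite mulrA pcoefS mulNr mulrC.
by rewrite mulrA.
Qed.

End Evaluation.

Lemma gphi_two n (v : nat -> grass n) : (forall j, v j.+2 = 0) ->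
  gphi n v = v 0%N - gth n * v 1%N.
Proof.
(* For [n = 0] the sum stops before index 1, but then [theta^2 = 0]. *)
case: n v => [|n] v v0.
  rewrite /gphi /gth big_ord1 big_ord0 oppr0 mul0r subr0 pcoef0.
  by rewrite scale1r expr0 mul1r.
rewrite /gphi !big_ord_recl big1 ?addr0 => [|j _]; last by rewrite v0 mulr0 scaler0.
rewrite pcoef0 scale1r expr0 mul1r /= expr1; congr (_ + _).
by rewrite /bump /= addn0 (_ : pcoef 1 = -1) ?scaleN1r // /pcoef expr1 divr1.
Qed.

(** * The projection to the supersphere *)

Section Projection.
Variables m n : nat.
Implicit Types (F G : SF n) (x y : Pt) (f g : Pt -> R).
Notation E := (Erad m).
Notation U := (punctured m).
Notation sm := (smooth m).

(** Smoothness away from the origin only: unlike [Cinf], it is stable under [E]. *)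
Definition smooth_sf F := forall S, sm (F S).
Definition jet x F (j : nat) : grass n := ev n x (fun S => iter j E (F S)).
Definition pullback x F : grass n := gphi n (jet x F).

Lemma ev_phi x F : ev n x (phi m n F) = pullback x F.
Proof.
rewrite /phi ev_big; apply: eq_bigr => j _.
rewrite ev_scal ev_mul ev_pow ev_theta2; congr (_ *: _).
by rewrite /pcoef RdivE RpowE INRE factE.
Qed.

(** [pullback] depends on derivatives, hence on more than the value at [x]; an algebraic identity is
    therefore checked at every point before it is pulled back. *)
Lemma ev_inj F G : (forall x, ev n x F = ev n x G) -> F = G.
Proof. by move=> FG; apply/funext => S; apply/funext => x; have := congr1 (@^~ S) (FG x). Qed.

Lemma eq_pullback x F G : smooth_sf F -> smooth_sf G -> U x -> (forall S y, U y -> F S y = G S y) -> pullback x F = pullback x G.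
Proof.
move=> sF sG Ux FG; apply: eq_gphi => j; apply/funext => S.
by apply: (eq_iterE m) => // y; apply: FG.
Qed.

Lemma pullback_add x F G : smooth_sf F -> smooth_sf G -> U x -> pullback x (sf_add F G) = pullback x F + pullback x G.
Proof.
move=> sF sG Ux; rewrite -gphiD; apply: eq_gphi => j; apply/funext => S.
exact: iterE_add.
Qed.

Lemma pullback_scal x (c : R) F : smooth_sf F -> U x -> pullback x (sf_scal c F) = c *: pullback x F.
Proof.
move=> sF Ux; rewrite -gphiZ; apply: eq_gphi => j; apply/funext => S.
exact: iterE_scale.
Qed.

Lemma sf_mul_evE g F S : sf_mul (sf_ev n g) F S = (fun x => Rmult (g x) (F S x)).
Proof.
apply/funext => x; have := congr1 (@^~ S) (ev_mul n x (sf_ev n g) F).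
by rewrite ev_ev -scalerAl mul1r.
Qed.

Lemma smooth_sf_ev g : sm g -> smooth_sf (sf_ev n g).
Proof.
move=> sg S; rewrite /sf_ev; case: (S == set0) => //; exact: smooth_const.
Qed.

Lemma jet_ev x g j : U x -> jet x (sf_ev n g) j = iter j E g x *: 1.
Proof.
move=> Ux; apply/funext => S; rewrite gscaleE goneE /jet /ev /sf_ev.
case: (S == set0); first by rewrite mulr1.
by rewrite mulr0; case: j => // j; apply: iterE_const.
Qed.

Lemma pullback_mulev x g F : sm g -> smooth_sf F -> U x ->
  pullback x (sf_mul (sf_ev n g) F) = pullback x (sf_ev n g) * pullback x F.
Proof.
move=> sg sF Ux; rewrite /pullback (eq_gphi _ (jet x (sf_ev n g)) (fun j => iter j E g x *: 1)); last first.
  by move=> j; apply: jet_ev.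
apply: gphi_mul => j; apply/funext => S; rewrite gsumE /jet /ev sf_mul_evE iterE_mul //.
by apply: eq_bigr => a _; rewrite INRE.
Qed.

(** The odd coordinates are of this kind: multiplication by them commutes with [E], so they leave
    the jet as a constant factor. *)
Definition sconst (C : SF n) := forall S x y, C S x = C S y.

Lemma sf_mul_constE C F S : sconst C ->
  sf_mul C F S = (fun x => \big[Rplus/0]_(A <- enum (powerset S))
     Rmult (Rmult (pow (-1) (ninv A (S :\: A))) (C A (fun _ => 0))) (F (S :\: A) x)).
Proof.
move=> cC; apply/funext => x; rewrite big_enum; apply: eq_bigr => A _.
by rewrite (cC A x (fun _ => 0)).
Qed.

Lemma smooth_sf_mulconst C F : sconst C -> smooth_sf F -> smooth_sf (sf_mul C F).
Proof.
move=> cC sF S; rewrite sf_mul_constE //; apply: smooth_sum => A; exact: smooth_scale.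
Qed.

Lemma pullback_mulconst x C F : sconst C -> smooth_sf F -> U x -> pullback x (sf_mul C F) = ev n x C * pullback x F.
Proof.
move=> cC sF Ux; rewrite -gphi_mull; apply: eq_gphi => j; apply/funext => S.
rewrite /jet /ev sf_mul_constE // iterE_sum //; last by move=> A; apply: smooth_scale.
rewrite gmulE big_enum; apply: eq_big => A; first by rewrite powersetE.
by move=> _; rewrite iterE_scale // RpowE (cC A x (fun _ => 0)).
Qed.

Lemma smooth_sf_mulev g F : sm g -> smooth_sf F -> smooth_sf (sf_mul (sf_ev n g) F).
Proof. by move=> sg sF S; rewrite sf_mul_evE; apply: smooth_mul. Qed.

Lemma smooth_sf_add F G : smooth_sf F -> smooth_sf G -> smooth_sf (sf_add F G).
Proof. by move=> sF sG S; apply: smooth_add. Qed.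

Lemma smooth_sf_scal (c : R) F : smooth_sf F -> smooth_sf (sf_scal c F).
Proof. by move=> sF S; apply: smooth_scale. Qed.

Lemma smooth_sf_dodd a F : smooth_sf F -> smooth_sf (sf_dodd a F).
Proof.
by move=> sF S; rewrite /sf_dodd; case: ((a < 2 * n)%N && _); [apply: smooth_scale | apply: smooth_const].
Qed.

Lemma jet_dodd x a F j : smooth_sf F -> U x -> jet x (sf_dodd a F) j = gdo n a (jet x F j).
Proof.
move=> sF Ux; apply/funext => S; rewrite /jet /gdo /ev /sf_dodd.
case: ((a < 2 * n)%N && _); first by rewrite iterE_scale.
by case: j => // j; apply: iterE_const.
Qed.

Lemma smooth_sf_dUp k F : (1 <= k)%N -> smooth_sf F -> smooth_sf (dUp m n k F).
Proof.
move=> k1 sF; rewrite /dUp; case: ifP => km.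
  by move=> S; apply: smooth_pd => //; rewrite prednK.
by case: ifP => _; apply: smooth_sf_scal; apply: smooth_sf_dodd.
Qed.

Lemma pullback_dUp x k F : (m < k)%N -> smooth_sf F -> U x ->
  pullback x (dUp m n k F) = gphi n (fun j => gup n (k - m) (jet x F j)).
Proof.
move=> mk sF Ux; apply: eq_gphi => j; rewrite /dUp leqNgt mk /= /gup.
case: ifP => _.
  apply/funext => S; rewrite /jet /ev iterE_scale //; last exact: smooth_sf_dodd.
  by rewrite gscaleE -jet_dodd.
apply/funext => S; rewrite /jet /ev iterE_scale //; last exact: smooth_sf_dodd.
by rewrite gscaleE -jet_dodd.
Qed.

Lemma gup_pullback x b F : (1 <= b <= 2 * n)%N -> smooth_sf F -> U x ->
  gup n b (pullback x F) = pullback x (dUp m n (m + b) F) - IZR 2 *: (gy n b.-1 * pullback x (fun S => E (F S))).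
Proof.
move=> bn sF Ux; rewrite gphi_up // pullback_dUp //; last by lia.
rewrite addKn; congr (_ - _ *: (_ * _)).
by apply: eq_gphi => j; apply/funext => S; rewrite /jet /ev iterSr.
Qed.

(** Since [g] is smooth around [x] in the ambient space, its derivative along the flow is the
    ambient field applied to it. For [i = j] the flow is constant by definition and both sides
    vanish. *)
Lemma LS_Lop i j g x : (1 <= i <= m)%N -> (1 <= j <= m)%N -> sm g -> U x ->
  LS i j g x = Lop i.-1 j.-1 g x.
Proof.
move=> im jm sg Ux; rewrite /LS /Lop; apply: dlim_eq.
case: (eqVneq i j) => [->|ij].
  have -> : (fun t => g (Defs.rot j.-1 j.-1 t x)) = fct_cte (g x).
    by apply/funext => t; congr g; apply/funext => k; rewrite /Defs.rot eqxx.
  by rewrite -Rplus_opp_r_scale; apply: derivable_pt_lim_const.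
rewrite -Rminus_scale; apply: (rot_der m) => //; try lia.
Qed.

(** A finite combination of entries of [v], with coefficients independent of the point, lets linear
    operators such as [Lop] through. *)
Lemma gphiE v S : gphi n v S = \big[Rplus/0%R]_(j < n.+1) \big[Rplus/0%R]_(A <- enum (powerset S))
  Rmult (pcoef j * ((-1) ^+ ninv A (S :\: A) * (gth n ^+ j) A)) (v j (S :\: A)).
Proof.
rewrite /gphi gsumE; apply: eq_bigr => j _; rewrite gscaleE gmulE big_enum mulr_sumr.
apply: eq_big => A; first by rewrite powersetE.
by move=> _; rewrite !RmultE !mulrA.
Qed.

Lemma phiE F S : phi m n F S = (fun x => \big[Rplus/0%R]_(j < n.+1) \big[Rplus/0%R]_(A <- enum (powerset S))
  Rmult (pcoef j * ((-1) ^+ ninv A (S :\: A) * (gth n ^+ j) A)) (iter j E (F (S :\: A)) x)).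
Proof. by apply/funext => x; rewrite -[LHS]/(ev n x (phi m n F) S) ev_phi /pullback gphiE. Qed.

Lemma ev_LS_phi i j F x : (1 <= i <= m)%N -> (1 <= j <= m)%N -> smooth_sf F -> U x ->
  ev n x (fun S => LS i j (phi m n F S)) = pullback x (fun S => Lop i.-1 j.-1 (F S)).
Proof.
move=> im jm sF Ux; have i1 : (i.-1 < m)%N by lia.
have j1 : (j.-1 < m)%N by lia.
have sI (p : nat) S : sm (iter p E (F S)) by apply: smooth_iterE.
apply/funext => S; rewrite /ev phiE LS_Lop //; last first.
  by do 2!(apply: smooth_sum => ?); apply: smooth_scale.
rewrite (Lop_sum m) //; last by move=> ?; apply: smooth_sum => ?; apply: smooth_scale.
rewrite /pullback gphiE; apply: eq_bigr => p _.
rewrite (Lop_sum m) //; last by move=> ?; apply: smooth_scale.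
by apply: eq_bigr => A _; rewrite (Lop_scale m) // /jet /ev iterE_Lop.
Qed.

Definition gser (c : nat -> R) : grass n := \sum_(k < n.+1) c k *: gth n ^+ k.

Lemma ev_tser x c : ev n x (tser n c) = gser c.
Proof.
by rewrite /tser ev_big; apply: eq_bigr => k _; rewrite ev_scal ev_pow ev_theta2.
Qed.

Lemma gser_even c : geven n (gser c).
Proof.
move=> S oS; rewrite /gser gsumE big1 // => k _; rewrite gscaleE.
by rewrite (gth_even n k) // mulr0.
Qed.

Definition gsq : grass n := gser (fun k => Rmult (gbinom (Rdiv 1 2) k) (pow (-1) k)).
Definition gisq : grass n := gser (fun k => Rmult (gbinom (Rdiv (-1) 2) k) (pow (-1) k)).

Lemma U_onS x : onS m x -> U x.
Proof. by rewrite /onS /punctured => ->; apply: R1_neq_R0. Qed.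

(** The projection of [x_i r^(-2q)] is [x_i] times the binomial series of [(1 - theta^2)^c] with
    [c = 1/2 - q]: [q = 0] gives the square root, [q = 1] its inverse. *)
Lemma pullback_coord_w q c i x : (i < m)%N -> onS m x ->
  (forall k, Rminus (Rminus (Rdiv 1 2) (INR q)) k = Rminus c k) ->
  pullback x (sf_ev n (fun y => Rmult (y i) (pow (inv_r2 m y) q))) =
  x i *: gser (fun k => Rmult (gbinom c k) (pow (-1) k)).
Proof.
move=> im xS cq; have Ux := U_onS _ xS.
rewrite /pullback /gphi /gser scaler_sumr; apply: eq_bigr => j _.
rewrite jet_ev // iterE_coord_wX // -scalerAr mulr1 !scalerA; congr (_ *: _).
have -> : inv_r2 m x = 1%R by rewrite /inv_r2 xS Rinv_1.
rewrite pow1 Rmult_1_r /gbinom /pcoef (eq_bigr (fun k : 'I_j => Rminus c (INR k))); last first.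
  by move=> k _; rewrite cq.
have -> : (-1) ^+ j = pow (-1) j :> R by rewrite RpowE.
rewrite -INRE factE RdivE; move: (pow (-1) j) (bigop _ _ _) (INR _`!) => a b d; ringR.
Qed.

Lemma pullback_coord i x : (i < m)%N -> onS m x ->
  pullback x (sf_ev n (fun y => y i)) = x i *: gsq.
Proof.
move=> im xS; rewrite -(pullback_coord_w 0) //; last by move=> k; rewrite Rminus_0_r.
by congr (pullback x (sf_ev n _)); apply/funext => y; rewrite Rmult_1_r.
Qed.

Lemma smooth_sf_coord i : (i < m)%N -> smooth_sf (sf_ev n (fun y => y i)).
Proof. by move=> im; apply: smooth_sf_ev; apply: smooth_coord. Qed.

Lemma pullback_one x : U x -> pullback x (sf_const n 1%R) = 1.
Proof.
move=> Ux; rewrite /pullback gphi_const => [|j]; first by rewrite jet_ev // scale1r.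
by rewrite jet_ev // iterE_const // scale0r.
Qed.

Lemma pullback_sum x (I : Type) (s : seq I) (H : I -> SF n) :
  (forall i, smooth_sf (H i)) -> U x ->
  pullback x (fun S y => \big[Rplus/0%R]_(i <- s) H i S y) = \sum_(i <- s) pullback x (H i).
Proof.
move=> sH Ux; elim: s => [|i s IH].
  rewrite big_nil -(scale0r (pullback x (sf_zero n))) -pullback_scal //; last by move=> S; apply: smooth_const.
  congr (pullback x _); apply/funext => S; apply/funext => y.
  by rewrite big_nil /sf_scal Rmult_0_l.
rewrite big_cons -IH -pullback_add //; last by move=> S; apply: smooth_sum => k; apply: sH.
by congr (pullback x _); apply/funext => S; apply/funext => y; rewrite big_cons.
Qed.

(** Since [E r2 = 1], the jet at a point of the unit sphere is 1, 1, 0, 0, and so on. *)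
Lemma pullback_r2 x : onS m x -> pullback x (sf_ev n (r2 m)) = 1 - gth n.
Proof.
move=> xS; have Ux := U_onS _ xS.
have j0 : jet x (sf_ev n (r2 m)) 0 = 1 by rewrite jet_ev // /= xS scale1r.
have j1 : jet x (sf_ev n (r2 m)) 1 = 1 by rewrite jet_ev // /= E_r2 // scale1r.
have j2 j : jet x (sf_ev n (r2 m)) j.+2 = 0.
  rewrite jet_ev // -addn1 iterD (eq_iterE m _ _ (fun _ => 1%R)) ?iterE_const ?scale0r //.
  - by apply: smooth_iterE; apply: smooth_r2.
  - exact: smooth_const.
  - by move=> y Uy; apply: E_r2.
by rewrite /pullback gphi_two // j0 j1 mulr1.
Qed.

(** Applied to [f_i = x_i], [g = r^2] and to [f_i = x_i / r^2], [g = 1], it yields the two relations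
    satisfied by [sq] and [isq]. *)
Lemma sum_P_coord x (f : 'I_m -> Pt -> R) g :
  (forall i, sm (f i)) -> sm g -> U x ->
  (forall y, U y -> \big[Rplus/0%R]_(i < m) Rmult (y i) (f i y) = g y) ->
  \sum_(i < m) pullback x (sf_ev n (fun y => y i)) * pullback x (sf_ev n (f i)) = pullback x (sf_ev n g).
Proof.
move=> sf sg Ux fg.
have sH (i : 'I_m) : smooth_sf (sf_mul (sf_ev n (fun y => y i)) (sf_ev n (f i))).
  by apply: smooth_sf_mulev; [apply: smooth_coord | apply: smooth_sf_ev].
rewrite (eq_bigr (fun i : 'I_m => pullback x (sf_mul (sf_ev n (fun y => y i)) (sf_ev n (f i))))).
  rewrite -pullback_sum //; apply: eq_pullback => //.
  - by move=> S; apply: smooth_sum => i; apply: sH.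
  - exact: smooth_sf_ev.
  move=> S y Uy; rewrite /sf_ev -fg //; case: (eqVneq S set0) => [->|S0].
    by apply: eq_bigr => i _; rewrite sf_mul_evE eqxx.
  by rewrite big1 // => i _; rewrite sf_mul_evE (negPf S0) Rmult_0_r.
by move=> i _; rewrite pullback_mulev //; [apply: smooth_coord | apply: smooth_sf_ev].
Qed.

(* Multiplicativity of the pullback gives [sq^2 = sum_i phi(x_i)^2 = phi(r^2)],
   which avoids any identity between binomial coefficients. *)
Lemma gsq2 x : onS m x -> gsq * gsq = 1 - gth n.
Proof.
move=> xS; have Ux := U_onS _ xS; rewrite -(pullback_r2 x) //.
rewrite -(sum_P_coord x (fun (i : 'I_m) y => y i) (r2 m)) //; first last.
- by move=> y _; apply: eq_bigr => i _; rewrite /= Rmult_1_r.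
- exact: smooth_r2.
- by move=> i; apply: smooth_coord.
rewrite (eq_bigr (fun i : 'I_m => (x i * x i) *: (gsq * gsq))); last first.
  by move=> i _; rewrite pullback_coord // -scalerAl -scalerAr scalerA.
rewrite -scaler_suml (_ : \sum_(i < m) _ = 1) ?scale1r //.
by rewrite -[RHS]xS /r2 /rsum; apply: eq_bigr => i _; rewrite /= Rmult_1_r.
Qed.

(** Projection of [sum_i x_i (x_i / r^2) = 1]: the factors become [x_i sq] and [x_i isq], and the
    squares of the [x_i] add up to 1. *)
Lemma gsq_isq x : onS m x -> gsq * gisq = 1.
Proof.
move=> xS; have Ux := U_onS _ xS; rewrite -(pullback_one x) //.
rewrite -(sum_P_coord x (fun (i : 'I_m) y => Rmult (y i) (pow (inv_r2 m y) 1)) (fun _ => 1%R)) //; first last.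
- move=> y Uy; transitivity (Rmult (r2 m y) (inv_r2 m y)); last exact: Rinv_r.
  rewrite {1}/r2 /rsum big_distrl; apply: eq_bigr => i _ /=; ring.
- exact: smooth_const.
- by move=> i; apply: smooth_mul; [apply: smooth_coord | apply: smooth_pow; apply: smooth_w].
rewrite (eq_bigr (fun i : 'I_m => (x i * x i) *: (gsq * gisq))); last first.
  move=> i _; rewrite pullback_coord // (pullback_coord_w 1 (Rdiv (-1) 2)) // => [|k].
    by rewrite -scalerAl -scalerAr scalerA.
  by rewrite /=; lra.
rewrite -scaler_suml (_ : \sum_(i < m) _ = 1) ?scale1r //.
by rewrite -[RHS]xS /r2 /rsum; apply: eq_bigr => i _; rewrite /= Rmult_1_r.
Qed.

End Projection.

Lemma big_nat_pick (V : zmodType) lo hi j (H : nat -> V) : (lo <= j < hi)%N ->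
  (forall k, k != j -> H k = 0) -> \sum_(lo <= k < hi) H k = H j.
Proof.
move=> jlh H0; rewrite (bigD1_seq j) ?mem_index_iota ?iota_uniq //=.
by rewrite big1 ?addr0.
Qed.

(** * The fields [J_ij] and [L_ij] correspond under the projection *)

Section Intertwining.
Variables m n : nat.
Implicit Types (F G : SF n) (x y : Pt) (f g : Pt -> R).
Notation E := (Erad m).
Notation U := (punctured m).
Notation sm := (smooth m).
Notation smF := (smooth_sf m n).
Notation P := (pullback m n).
Notation ev := (ev n).
Notation gy := (gy n).
Notation gup := (gup n).
Notation gsq := (gsq n).
Notation gisq := (gisq n).
Notation inr i := (1 <= i <= m + 2 * n)%N.

(* the pullback of the coordinate [X_i]; see [pullback_X] *)
Definition proj_coord x i : grass n := if (i <= m)%N then x i.-1 *: gsq else gy (i - m).-1.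

Lemma smooth_sf_mulX i F : (1 <= i)%N -> smF F -> smF (sf_mul (Xc m n i) F).
Proof.
move=> i1 sF; rewrite /Xc; case: ifP => im; last exact: smooth_sf_mulconst.
by apply: smooth_sf_mulev => //; apply: smooth_coord; rewrite prednK.
Qed.

Lemma pullback_mulX x i F : (1 <= i)%N -> smF F -> onS m x ->
  P x (sf_mul (Xc m n i) F) = proj_coord x i * P x F.
Proof.
move=> i1 sF xS; have Ux := U_onS _ _ xS; rewrite /Xc /proj_coord; case: ifP => im.
  have im' : (i.-1 < m)%N by rewrite prednK.
  by rewrite pullback_mulev // ?pullback_coord //; apply: smooth_coord.
by rewrite pullback_mulconst.
Qed.

Definition Lsign i j : R := if par m i && par m j then IZR 1 else IZR (-1).

Lemma actR_Lf i j F : inr i -> inr j -> actR m n (Lf m n i j) F =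
  sf_add (sf_mul (Xc m n i) (dUp m n j F)) (sf_scal (Lsign i j) (sf_mul (Xc m n j) (dUp m n i F))).
Proof.
move=> hi hj; apply: ev_inj => x; rewrite /actR ev_sum ev_add ev_scal !ev_mul.
rewrite (eq_bigr (fun k => (if k == j then ev x (Xc m n i) else 0) * ev x (dUp m n k F) +
   Lsign i j *: ((if k == i then ev x (Xc m n j) else 0) * ev x (dUp m n k F)))); last first.
  move=> k _; rewrite ev_mul ev_add ev_scal mulrDl -scalerAl.
  by congr (_ * _ + _ *: (_ * _)); case: ifP.
rewrite big_split (@big_nat_pick _ _ _ j) ?ltnS //= => [|k /negPf ->]; last by rewrite mul0r.
rewrite (@big_nat_pick _ _ _ i) ?ltnS //= => [|k /negPf ->]; last by rewrite mul0r scaler0.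
by rewrite !eqxx.
Qed.

Lemma pullback_actR x i j F : inr i -> inr j -> smF F -> onS m x ->
  P x (actR m n (Lf m n i j) F) =
  proj_coord x i * P x (dUp m n j F) + Lsign i j *: (proj_coord x j * P x (dUp m n i F)).
Proof.
move=> /[dup] hi /andP[i1 _] /[dup] hj /andP[j1 _] sF xS; have Ux := U_onS _ _ xS.
have sj := smooth_sf_dUp m n _ _ j1 sF; have si := smooth_sf_dUp m n _ _ i1 sF.
rewrite actR_Lf // pullback_add //; [|exact: smooth_sf_mulX|by apply: smooth_sf_scal; apply: smooth_sf_mulX].
by rewrite pullback_scal ?pullback_mulX //; apply: smooth_sf_mulX.
Qed.

Lemma ev_actS x (V : VFS n) G : ev x (actS m n V G) =
  \sum_(1 <= i < m.+1) \sum_(1 <= j < m.+1) ev x (V.1 i j) * ev x (fun S => LS i j (G S)) +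
  \sum_(1 <= a < (2 * n).+1) ev x (V.2 a) * gdo n a.-1 (ev x G).
Proof.
rewrite /actS ev_add !ev_sum; congr (_ + _).
  by apply: eq_bigr => i _; rewrite ev_sum; apply: eq_bigr => j _; rewrite ev_mul.
by apply: eq_bigr => a _; rewrite ev_mul.
Qed.

Lemma sum_dyUpc b (c u : grass n) : (1 <= b <= 2 * n)%N ->
  \sum_(1 <= a < (2 * n).+1) (dyUpc b a *: c) * gdo n a.-1 u = c * gup b u.
Proof.
move=> bn; rewrite /gup; case: ifP => ob.
  rewrite (@big_nat_pick _ _ _ b.+1); last by move=> k /negPf kb; rewrite /dyUpc ob kb scale0r mul0r.
    by rewrite /dyUpc ob eqxx -scalerAl -scalerAr.
  lia.
rewrite (@big_nat_pick _ _ _ b.-1); last by move=> k /negPf kb; rewrite /dyUpc ob kb scale0r mul0r.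
  by rewrite /dyUpc ob eqxx -scalerAl -scalerAr.
lia.
Qed.

Lemma dUp_even k F S : (k <= m)%N -> dUp m n k F S = pd k.-1 (F S).
Proof. by rewrite /dUp => ->. Qed.

Lemma intertwine_even i j F x : (1 <= i <= m)%N -> (1 <= j <= m)%N -> smF F -> onS m x ->
  ev x (actS m n (Jf m n i j) (phi m n F)) = P x (actR m n (Lf m n i j) F).
Proof.
move=> hi hj sF xS; have Ux := U_onS _ _ xS.
have [/andP[i1 im] /andP[j1 jm]] := (hi, hj).
rewrite ev_actS /Jf im jm /= [X in _ + X]big1 ?addr0 => [|a _]; last by rewrite ev_zero mul0r.
rewrite (@big_nat_pick _ _ _ i) ?ltnS // => [|k /negPf ki]; last first.
  by apply: big1 => l _; rewrite ki ev_zero mul0r.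
rewrite (@big_nat_pick _ _ _ j) ?ltnS // => [|k /negPf ki]; last first.
  by rewrite ki andbF ev_zero mul0r.
rewrite !eqxx ev_const scale1r mul1r ev_LS_phi //; congr (P x _).
rewrite actR_Lf; try lia.
apply/funext => S; apply/funext => y; rewrite /sf_add /sf_scal.
rewrite /Xc im jm !sf_mul_evE !dUp_even // /Lsign /par.
by rewrite !ltnNge im jm.
Qed.

(** Each derivative leaves an error [-2 y_b phi(E F)]; the resulting coefficients [y_i y_j] and
    [y_j y_i] cancel by anticommutation. *)
Lemma intertwine_odd i j F x : (m < i <= m + 2 * n)%N -> (m < j <= m + 2 * n)%N ->
  smF F -> onS m x ->
  ev x (actS m n (Jf m n i j) (phi m n F)) = P x (actR m n (Lf m n i j) F).
Proof.
move=> /andP[mi im] /andP[mj jm] sF xS; have Ux := U_onS _ _ xS.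
rewrite pullback_actR //; try lia.
rewrite ev_actS /Jf [(i <= m)%N]leqNgt mi mj /= big1 ?add0r => [|p _]; last first.
  by apply: big1 => q _; rewrite ev_zero mul0r.
rewrite (eq_bigr (fun a => (dyUpc (j - m) a *: gy (i - m).-1) * gdo n a.-1 (P x F) +
   (dyUpc (i - m) a *: gy (j - m).-1) * gdo n a.-1 (P x F))); last first.
  by move=> a _; rewrite ev_add !ev_scal ev_phi mulrDl.
have bj : (1 <= j - m <= 2 * n)%N by lia.
have bi : (1 <= i - m <= 2 * n)%N by lia.
rewrite big_split !sum_dyUpc //= !gup_pullback // !subnKC ?(ltnW mi) ?(ltnW mj) //.
rewrite /Lsign /par mi mj scale1r /proj_coord [(i <= m)%N]leqNgt mi [(j <= m)%N]leqNgt mj /=.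
rewrite !mulrBr addrACA -[RHS]addr0; congr (_ + _).
rewrite -!scalerAr !mulrA (godd_anti n (gy (j - m).-1)); try exact: gy_odd.
by rewrite mulNr scalerN opprK addNr.
Qed.

(* Pullback of [sum_p x_p L_pi = r^2 (d_i - 2 x_i E)]. *)
Lemma pullback_tangential i F x : (1 <= i <= m)%N -> smF F -> onS m x ->
  gsq * \sum_(1 <= p < m.+1) x p.-1 *: P x (fun S => Lop p.-1 i.-1 (F S)) =
  (1 - gth n) * (P x (dUp m n i F) - IZR 2 *: (proj_coord x i * P x (fun S => E (F S)))).
Proof.
move=> /andP[i1 im] sF xS; have Ux := U_onS _ _ xS.
have im' : (i.-1 < m)%N by rewrite prednK.
have sE : smF (fun S => E (F S)) by move=> S; apply: smooth_E.
have sD : smF (dUp m n i F) by apply: smooth_sf_dUp.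
have sL (p : 'I_m) : smF (fun S => Lop p i.-1 (F S)) by move=> S; apply: smooth_Lop.
have sXE : smF (sf_mul (Xc m n i) (fun S => E (F S))) by apply: smooth_sf_mulX.
have sG : smF (sf_add (dUp m n i F) (sf_scal (IZR (-2)) (sf_mul (Xc m n i) (fun S => E (F S))))).
  by apply: smooth_sf_add => //; apply: smooth_sf_scal.
rewrite big_add1 big_mkord mulr_sumr.
(* The prefactor [sq] completes [x_p] to [phi(x_p)], so each term is the projection of
   [x_p L_pi F]. *)
rewrite (eq_bigr (fun p : 'I_m => P x (sf_mul (sf_ev n (fun y => y p)) (fun S => Lop p i.-1 (F S))))); last first.
  by move=> p _; rewrite pullback_mulev ?pullback_coord -?scalerAl -?scalerAr //; apply: smooth_coord.
have sM (p : 'I_m) : smF (sf_mul (sf_ev n (fun y => y p)) (fun S => Lop p i.-1 (F S))).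
  by apply: smooth_sf_mulev => //; apply: smooth_coord.
rewrite -pullback_sum // -(pullback_r2 m n x) //.
transitivity (P x (sf_mul (sf_ev n (r2 m))
    (sf_add (dUp m n i F) (sf_scal (IZR (-2)) (sf_mul (Xc m n i) (fun S => E (F S))))))).
  apply: eq_pullback => //; first by move=> S; apply: smooth_sum => p; apply: sM.
    by apply: smooth_sf_mulev => //; apply: smooth_r2.
  move=> S y Uy; rewrite sf_mul_evE /sf_add /sf_scal dUp_even // /Xc im sf_mul_evE.
  rewrite (eq_bigr (fun p : 'I_m => Rplus (Rmult (pow (y p) 2) (pd i.-1 (F S) y))
     (Rmult (Rmult (-1) (y i.-1)) (Rmult (y p) (pd p (F S) y))))); last first.
    by move=> p _; rewrite sf_mul_evE /Lop; ringR.
  rewrite big_split -big_distrl -big_distrr /=; exact: Rtangential.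
rewrite pullback_mulev //; last exact: smooth_r2.
rewrite pullback_add //; last exact: smooth_sf_scal.
rewrite pullback_scal // pullback_mulX //; congr (_ * (_ + _)).
by rewrite -scaleNr -RoppE -opp_IZR.
Qed.

(** Both halves of [Jmixed] leave the error [2 y_j phi(x_i) phi(E F)], the odd half through
    [gup_pullback], the even half through [pullback_tangential], with opposite signs. *)
Lemma intertwine_mixed i j F x : (1 <= i <= m)%N -> (m < j <= m + 2 * n)%N ->
  smF F -> onS m x ->
  ev x (actS m n (Jmixed m n i j) (phi m n F)) =
  proj_coord x i * P x (dUp m n j F) - proj_coord x j * P x (dUp m n i F).
Proof.
move=> hi /andP[mj jm] sF xS; have Ux := U_onS _ _ xS; have /andP[i1 im] := hi.
have bj : (1 <= j - m <= 2 * n)%N by lia.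
set b := (j - m)%N in bj *.
have cq := gser_even n; have cQ u : gsq * u = u * gsq by apply: gevenC; apply: cq.
have cP u : gisq * u = u * gisq by apply: gevenC; apply: cq.
have hj : proj_coord x j = gy b.-1 by rewrite /proj_coord leqNgt mj.
have hiE : proj_coord x i = x i.-1 *: gsq by rewrite /proj_coord im.
rewrite ev_actS /= ev_phi.
have -> : \sum_(1 <= a < (2 * n).+1) ev x (sf_scal (dyUpc b a) (sf_mul (xi n i) (sq n))) *
    gdo n a.-1 (P x F) = proj_coord x i * gup b (P x F).
  rewrite -sum_dyUpc //; apply: eq_bigr => a _; rewrite ev_scal ev_mul ev_ev ev_tser hiE.
  by rewrite -(scalerAl (x i.-1)) mul1r.
have -> : \sum_(1 <= p < m.+1) \sum_(1 <= q < m.+1)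
    ev x (if q == i then sf_opp (sf_mul (sf_mul (ygen n b) (isq n)) (xi n p)) else sf_zero n) *
    ev x (fun S => LS p q (phi m n F S)) =
   - (gy b.-1 * (gisq * \sum_(1 <= p < m.+1) x p.-1 *: P x (fun S => Lop p.-1 i.-1 (F S)))).
  rewrite !mulr_sumr -sumrN; apply: eq_big_nat => p hp.
  rewrite (@big_nat_pick _ _ _ i) ?ltnS // => [|k /negPf ki]; last by rewrite ki ev_zero mul0r.
  rewrite eqxx ev_opp !ev_mul ev_ev ev_tser ev_LS_phi //.
  by rewrite mulNr -!scalerAr mulr1 -!scalerAl mulrA.
set Sg := \sum_(_ <= p < _) _.
have -> : gisq * Sg = P x (dUp m n i F) - IZR 2 *: (proj_coord x i * P x (fun S => E (F S))).
  (* With [1 - theta^2] written as [sq^2], multiplying twice by [isq] clears the right side and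
     leaves a single [isq] before the sum. *)
  have := pullback_tangential _ _ _ hi sF xS; rewrite -/Sg -(gsq2 _ _ _ xS) => /(congr1 (fun u => gisq * (gisq * u))).
  have PQ u : gisq * (gsq * u) = u by rewrite mulrA cP (gsq_isq _ _ _ xS) mul1r.
  by rewrite -mulrA !PQ.
rewrite (gup_pullback m) // /b subnKC ?(ltnW mj) // -/b hj.
have -> : gy b.-1 * (P x (dUp m n i F) - IZR 2 *: (proj_coord x i * P x (fun S => E (F S)))) =
    gy b.-1 * P x (dUp m n i F) - proj_coord x i * (IZR 2 *: (gy b.-1 * P x (fun S => E (F S)))).
  rewrite mulrBr; congr (_ - _); rewrite -!scalerAr !mulrA hiE.
  by congr (_ *: (_ * _)); rewrite -scalerAr -scalerAl cQ.
by rewrite opprB mulrBr addrC addrA subrK.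
Qed.

Lemma intertwine i j F x : inr i -> inr j -> smF F -> onS m x ->
  ev x (actS m n (Jf m n i j) (phi m n F)) = P x (actR m n (Lf m n i j) F).
Proof.
move=> /[dup] hi /andP[i1 im] /[dup] hj /andP[j1 jm] sF xS.
have [ei|oi] := leqP i m; have [ej|oj] := leqP j m.
- by apply: intertwine_even; rewrite ?i1 ?j1.
- rewrite pullback_actR // /Jf ei [(j <= m)%N]leqNgt oj /= ltnNge ei /= intertwine_mixed ?i1 ?oj //.
  by rewrite /Lsign /par ltnNge ei /= scaleN1r.
- rewrite pullback_actR // /Jf ej [(i <= m)%N]leqNgt oi /= ltnNge ej /=.
  have -> : ev x (actS m n (vfs_opp (Jmixed m n j i)) (phi m n F)) =
      - ev x (actS m n (Jmixed m n j i) (phi m n F)).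
    rewrite !ev_actS opprD -!sumrN; congr (_ + _); apply: eq_bigr => p _.
      by rewrite -sumrN; apply: eq_bigr => q _; rewrite ev_opp mulNr.
    by rewrite ev_opp mulNr.
  rewrite intertwine_mixed ?j1 ?oi // /Lsign /par [(m < j)%N]ltnNge ej andbF scaleN1r opprB //.
- by apply: intertwine_odd; rewrite ?oi ?oj.
Qed.

End Intertwining.
(** * Metrics *)

Section AmbientMetric.
Variables m n : nat.
Implicit Types (F G : SF n) (x y : Pt).
Notation smF := (smooth_sf m n).
Notation P := (pullback m n).
Notation ev := (ev n).
Notation hX := (proj_coord m n).
Notation Lsign := (Lsign m).
Notation Xc := (Xc m n).
Notation gpar := (gpar n).
Notation inr i := (1 <= i <= m + 2 * n)%N.

(* [<d_{X^j} | d_{X^l}>] *)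
Definition gcov (j l : nat) : R :=
  if (j <= m)%N then kd j l
  else if odd (j - m) then (if l == j.+1 then IZR 2 else IZR 0)
  else (if l == j.-1 then IZR (-2) else IZR 0).

(** The sign of moving the coefficient [X_k] past [d_{X^j}]. *)
Definition psign (j k : nat) : R := if par m j && par m k then IZR (-1) else IZR 1.

(** The pairing of [d_{X^j}] with [W]. In odd directions [d_{X^j}] is a multiple of the lower-index
    field of its partner, so the partner's component of [W] enters, twisted by [gpar]. *)
Definition raise y (W : VFR n) (j : nat) : grass n :=
  if (j <= m)%N then ev y (W j)
  else if odd (j - m) then IZR 2 *: gpar (ev y (W j.+1))
  else IZR (-2) *: gpar (ev y (W j.-1)).

Lemma ev_metR y V W : ev y (metR m n V W) = \sum_(1 <= p < (m + 2 * n).+1)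
  ev y (lowR m n V p) * (if par m p then gpar (ev y (W p)) else ev y (W p)).
Proof.
rewrite /metR ev_sum; apply: eq_bigr => p _; rewrite ev_mul; congr (_ * _).
by case: ifP => _; rewrite ?ev_inv.
Qed.

Definition single (j : nat) (X : SF n) : VFR n := fun k => if k == j then X else sf_zero n.

Lemma ev_scal0 y (c : R) : ev y (sf_scal c (sf_zero n)) = 0.
Proof. by rewrite ev_scal ev_zero scaler0. Qed.

Lemma metR_single y j X W : inr j ->
  ev y (metR m n (single j X) W) = ev y X * raise y W j.
Proof.
move=> hj; rewrite ev_metR /raise; case: (leqP j m) => jm.
  rewrite (@big_nat_pick _ _ _ j) ?ltnS //.
    by rewrite /lowR /single /par jm eqxx ltnNge jm.
  move=> p /negPf pj; rewrite /lowR /single pj; case: leqP => pm; first by rewrite ev_zero mul0r.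
  case: ifP => op; rewrite ifN ?ev_scal0 ?mul0r //; lia.
case: ifP => oj.
  rewrite (@big_nat_pick _ _ _ j.+1); last first.
  - move=> p /negPf pj; rewrite /lowR /single; case: (leqP p m) => pm; last case: ifP => op;
      rewrite ifN ?ev_scal0 ?ev_zero ?mul0r //; lia.
  - lia.
  have pm : (m < j.+1)%N by lia.
  have op : odd (j.+1 - m) = false by lia.
  by rewrite /lowR /single /par leqNgt pm op /= eqxx ev_scal -scalerAl -scalerAr.
rewrite (@big_nat_pick _ _ _ j.-1); last first.
- move=> p /negPf pj; rewrite /lowR /single; case: (leqP p m) => pm; last case: ifP => op;
    rewrite ifN ?ev_scal0 ?ev_zero ?mul0r //; lia.
- lia.
have pm : (m < j.-1)%N by lia.
have op : odd (j.-1 - m) by lia.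
rewrite /lowR /single /par leqNgt pm op /= prednK; last by lia.
by rewrite eqxx ev_scal -scalerAl -scalerAr.
Qed.

Lemma metR_Lf y i j W : inr i -> inr j -> ev y (metR m n (Lf m n i j) W) =
  ev y (Xc i) * raise y W j + Lsign i j *: (ev y (Xc j) * raise y W i).
Proof.
move=> hi hj; rewrite -!metR_single // !ev_metR scaler_sumr -big_split; apply: eq_bigr => p _ /=.
rewrite scalerAl -mulrDl; congr (_ * _); rewrite /lowR /Lf /single -/(Lsign i j).
by do 2!case: ifP => // _; rewrite !ev_scal ev_add ev_scal scalerDr !scalerA; congr (_ + _ *: _); rewrite mulrC.
Qed.

Lemma raise_Lf y k l j : inr j -> raise y (Lf m n k l) j =
  (psign j k * gcov j l) *: ev y (Xc k) + (Lsign k l * (psign j l * gcov j k)) *: ev y (Xc l).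
Proof.
move=> hj.
have parX a : gpar (ev y (Xc a)) = (if par m a then IZR (-1) else IZR 1) *: ev y (Xc a).
  rewrite /Defs.Xc /par ltnNge; case: ifP => _ /=.
    rewrite scale1r gpar_even // ev_ev => S oS; rewrite gscaleE (gdeg1 n) ?mulr0 //.
    by apply: contraTneq oS => ->.
  by rewrite ev_gen gpar_odd ?scaleN1r //; apply: gy_odd.
have evL p : ev y (Lf m n k l p) = (l == p)%:R *: ev y (Xc k) + (Lsign k l * (k == p)%:R) *: ev y (Xc l).
  rewrite /Lf ev_add ev_scal -/(Lsign k l) -scalerA !(eq_sym _ p); congr (_ + _ *: _).
    by case: ifP => _; rewrite ?scale1r ?scale0r.
  by case: ifP => _; rewrite ?scale1r ?scale0r.
rewrite /raise /gcov /psign; case: leqP => jm.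
  rewrite evL /par ltnNge jm /= !mul1r /kd.
  by rewrite !(eq_sym _ j); congr (_ *: _ + (_ * _) *: _); case: ifP.
rewrite /par jm /= -!/(par m _).
have bR (b : bool) (c : R) : c * b%:R = if b then c else IZR 0.
  by case: b; rewrite ?mulr1 ?mulr0.
by case: ifP => oj; rewrite evL gparD !gparZ !parX scalerDr !scalerA -!bR;
  congr (_ *: _ + _ *: _); ringR.
Qed.

(** The expansion of [<L_ij, L_kl>] with every coordinate replaced by its projection; the metrics of
    both spaces are reduced to it. *)
Definition amb_form x i j k l : grass n :=
  hX x i * ((psign j k * gcov j l) *: hX x k + (Lsign k l * (psign j l * gcov j k)) *: hX x l) +
  Lsign i j *: (hX x j *
    ((psign i k * gcov i l) *: hX x k + (Lsign k l * (psign i l * gcov i k)) *: hX x l)).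

Lemma smooth_sf_X i : (1 <= i)%N -> smF (Xc i).
Proof.
move=> i1; rewrite /Defs.Xc; case: ifP => im; first by apply: smooth_sf_coord; rewrite prednK.
by move=> S; apply: smooth_const.
Qed.

Lemma pullback_X x i : (1 <= i)%N -> onS m x -> P x (Xc i) = hX x i.
Proof.
move=> i1 xS; have Ux := U_onS _ _ xS.
have s1 : smF (sf_const n (IZR 1)) by apply: smooth_sf_ev; apply: smooth_const.
rewrite -[RHS]mulr1 -(pullback_one m n x) // -pullback_mulX //; congr (P x _).
by apply: ev_inj => y; rewrite ev_mul ev_const scale1r mulr1.
Qed.

Lemma pullback_metR x i j k l : inr i -> inr j -> inr k -> inr l -> onS m x ->
  P x (metR m n (Lf m n i j) (Lf m n k l)) = amb_form x i j k l.
Proof.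
move=> hi hj hk hl xS; have Ux := U_onS _ _ xS.
have [/andP[i1 _] /andP[j1 _]] := (hi, hj); have [/andP[k1 _] /andP[l1 _]] := (hk, hl).
(* [B a] is [<d_{X^a}, L_kl>], linear in the coordinates, so the metric becomes a sum of products to
   which [pullback_mulX] applies. *)
pose B a := sf_add (sf_scal (psign a k * gcov a l) (Xc k)) (sf_scal (Lsign k l * (psign a l * gcov a k)) (Xc l)).
have sB a : smF (B a) by apply: smooth_sf_add; apply: smooth_sf_scal; apply: smooth_sf_X.
have PB a : P x (B a) = (psign a k * gcov a l) *: hX x k + (Lsign k l * (psign a l * gcov a k)) *: hX x l.
  by rewrite pullback_add ?pullback_scal ?pullback_X //; try (by apply: smooth_sf_scal; apply: smooth_sf_X); apply: smooth_sf_X.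
have -> : metR m n (Lf m n i j) (Lf m n k l) =
    sf_add (sf_mul (Xc i) (B j)) (sf_scal (Lsign i j) (sf_mul (Xc j) (B i))).
  by apply: ev_inj => y; rewrite metR_Lf // !raise_Lf // ev_add ev_scal !ev_mul.
rewrite pullback_add ?pullback_scal ?pullback_mulX ?PB //; try exact: smooth_sf_mulX.
by apply: smooth_sf_scal; apply: smooth_sf_mulX.
Qed.

End AmbientMetric.

(** * The metric of the supersphere, one contraction at a time *)

Section SphereMetric.
Variables (m n : nat) (x : Pt).
Hypothesis xS : onS m x.
Notation ev := (ev n).
Notation hX := (proj_coord m n).
Notation gpar := (gpar n).
Notation gy := (gy n).
Notation gsq := (gsq n).
Notation gisq := (gisq n).
Notation gth := (gth n).

Definition rho (i j k l : nat) : R :=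
  (x i.-1 * x k.-1 * kd j l + - (x i.-1 * x l.-1 * kd j k) +
   - (x j.-1 * x k.-1 * kd i l) + x j.-1 * x l.-1 * kd i k).

(** Splitting [metS] into one contraction per argument lets each kind of [J_ij] be contracted once
    for all cases. *)
Definition contr_even (V : VFS n) (H : nat -> nat -> grass n) : grass n :=
  \sum_(1 <= p < m.+1) \sum_(1 <= q < m.+1) ev x (V.1 p q) * H p q.
Definition contr_odd (V : VFS n) (H : nat -> grass n) : grass n :=
  \sum_(1 <= a < (2 * n).+1) ev x (V.2 a) * H a.
(** [gpar] is the sign of moving the second coefficient past the odd field [d_{y_a}]. *)
Definition contr_odd_par (V : VFS n) (H : nat -> grass n) : grass n :=
  \sum_(1 <= a < (2 * n).+1) gpar (ev x (V.2 a)) * H a.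

Lemma ev_metS V W : ev x (metS m n V W) =
  contr_even V (fun p q => contr_even W (fun k l => rho p q k l *: (1 - gth))) +
  contr_odd V (fun a => contr_odd_par W (fun b => ev x (gS n a b))).
Proof.
rewrite /metS ev_add !ev_sum; congr (_ + _).
  apply: eq_bigr => p _; rewrite ev_sum; apply: eq_bigr => q _; rewrite ev_sum /contr_even mulr_sumr.
  apply: eq_bigr => k _; rewrite ev_sum mulr_sumr; apply: eq_bigr => l _.
  rewrite !ev_mul ev_add ev_opp ev_const ev_theta2 ev_ev scale1r -scalerAr mulr1 mulrA.
  by congr (_ * (_ *: _)).
apply: eq_bigr => a _; rewrite ev_sum /contr_odd_par mulr_sumr; apply: eq_bigr => b _.
by rewrite !ev_mul ev_inv mulrA.
Qed.

(** Passes from values on the fields [d_{y_a}] to the value on [d_{y^b}]. *)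
Definition Dy (b : nat) (H : nat -> grass n) : grass n :=
  \sum_(1 <= a < (2 * n).+1) dyUpc b a *: H a.

Lemma DyE b H : (1 <= b <= 2 * n)%N ->
  Dy b H = if odd b then IZR 2 *: H b.+1 else IZR (-2) *: H b.-1.
Proof.
move=> bn; rewrite /Dy; case: ifP => ob.
  rewrite (@big_nat_pick _ _ _ b.+1); last by move=> k /negPf kb; rewrite /dyUpc ob kb scale0r.
    by rewrite /dyUpc ob eqxx.
  lia.
rewrite (@big_nat_pick _ _ _ b.-1); last by move=> k /negPf kb; rewrite /dyUpc ob kb scale0r.
  by rewrite /dyUpc ob eqxx.
lia.
Qed.

Lemma eq_Dy b H H' : (forall a, H a = H' a) -> Dy b H = Dy b H'.
Proof. by move=> HH; apply: eq_bigr => a _; rewrite HH. Qed.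

Lemma Dy0 b : Dy b (fun _ => 0) = 0.
Proof. by rewrite /Dy big1 // => a _; rewrite scaler0. Qed.

Lemma DyD b H H' : Dy b (fun a => H a + H' a) = Dy b H + Dy b H'.
Proof. by rewrite -big_split; apply: eq_bigr => a _; rewrite scalerDr. Qed.

Lemma DyN b H : Dy b (fun a => - H a) = - Dy b H.
Proof. by rewrite -sumrN; apply: eq_bigr => a _; rewrite scalerN. Qed.

Lemma Dy_mull b u H : Dy b (fun a => u * H a) = u * Dy b H.
Proof. by rewrite mulr_sumr; apply: eq_bigr => a _; rewrite scalerAr. Qed.

Lemma Dy_mulr b u H : Dy b (fun a => H a * u) = Dy b H * u.
Proof. by rewrite mulr_suml; apply: eq_bigr => a _; rewrite scalerAl. Qed.

Lemma Dy_yUp b : (1 <= b <= 2 * n)%N -> Dy b (fun a => ev x (yUp n a)) = - gy b.-1.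
Proof.
move=> bn; rewrite DyE // /yUp; case: ifP => ob.
  rewrite /= ob /= ev_scal scalerA /ygen ev_gen.
  by rewrite -scaleN1r; congr (_ *: _); eqR; lra.
have -> : odd b.-1 by lia.
have -> : b.-1.+1 = b by lia.
rewrite ev_scal scalerA /ygen ev_gen.
by rewrite -scaleN1r; congr (_ *: _); eqR; lra.
Qed.

Lemma Dy_Jm l a : (1 <= l <= 2 * n)%N ->
  Dy l (fun b => (Jm b a : R) *: 1) = (a == l)%:R *: 1.
Proof.
move=> ln; rewrite DyE // /Jm; case: ifP => ol.
  rewrite /= ol /= eqSS scalerA; congr (_ *: _).
  by case: (a == l); rewrite ?mulr1n ?mulr0n; eqR; lra.
have -> : odd l.-1 by lia.
have -> : l.-1.+1 = l by lia.
rewrite /= scalerA; congr (_ *: _).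
by case: (a == l); rewrite ?mulr1n ?mulr0n; eqR; lra.
Qed.

Definition gK : grass n := gser n (fun _ => IZR 1).

(* [<d_{y^j}, d_{y^l}>] on the supersphere *)
Definition gS_up (j l : nat) : grass n := dyUpc j l *: 1 + gy j.-1 * gy l.-1 * gK.

(** The matrix [J] turns into the coefficients of the basis change, and each slot sends [y^a] to
    minus a generator, so the two signs cancel. *)
Lemma Dy_gS j l : (1 <= j <= 2 * n)%N -> (1 <= l <= 2 * n)%N ->
  Dy j (fun a => Dy l (fun b => ev x (gS n a b))) = gS_up j l.
Proof.
move=> jn ln.
rewrite (eq_Dy _ _ (fun a => (a == l)%:R *: 1 + ev x (yUp n a) * (- gy l.-1 * gK))); last first.
  move=> a; rewrite (eq_Dy _ _ (fun b => (Jm b a : R) *: 1 + ev x (yUp n a) * (ev x (yUp n b) * gK))).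
    by rewrite DyD Dy_Jm // Dy_mull Dy_mulr Dy_yUp.
  by move=> b; rewrite /gS ev_add ev_const !ev_mul ev_tser mulrA.
rewrite DyD Dy_mulr Dy_yUp // mulrA mulrNN; congr (_ + _).
rewrite /Dy (@big_nat_pick _ _ _ l) ?ltnS // => [|k /negPf ->]; last by rewrite scale0r scaler0.
by rewrite eqxx scale1r.
Qed.

(** Geometric series, exact because [theta^(2n+2) = 0]. *)
Lemma gK_inv : (1 - gth) * gK = 1.
Proof.
have := subrX1 gth n.+1; rewrite gthX_gt // => h.
rewrite -opprB mulNr /gK /gser (eq_bigr (fun k : 'I_n.+1 => gth ^+ k)).
  by rewrite -h sub0r opprK.
by move=> k _; rewrite scale1r.
Qed.

Lemma contr_even_JE i j H : (1 <= i <= m)%N -> (1 <= j <= m)%N -> contr_even (Jf m n i j) H = H i j.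
Proof.
move=> hi hj; have [/andP[i1 im] /andP[j1 jm]] := (hi, hj).
rewrite /contr_even /Jf im jm /= (@big_nat_pick _ _ _ i) ?ltnS // => [|k /negPf ki]; last first.
  by apply: big1 => l _; rewrite ki ev_zero mul0r.
rewrite (@big_nat_pick _ _ _ j) ?ltnS // => [|k /negPf ki]; last by rewrite ki andbF ev_zero mul0r.
by rewrite !eqxx ev_const scale1r mul1r.
Qed.

Lemma contr_even_JM i j H : (1 <= i <= m)%N -> contr_even (Jmixed m n i j) H =
  - (gy (j - m).-1 * gisq * \sum_(1 <= p < m.+1) x p.-1 *: H p i).
Proof.
move=> hi; rewrite /contr_even mulr_sumr -sumrN; apply: eq_bigr => p _ /=.
rewrite (@big_nat_pick _ _ _ i) ?ltnS // => [|k /negPf ki]; last by rewrite ki ev_zero mul0r.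
rewrite eqxx ev_opp !ev_mul ev_ev ev_tser mulNr; congr (- _).
by rewrite -!scalerAr mulr1 -scalerAl.
Qed.

Lemma contr_even_JO i j H : (m < i)%N -> (m < j)%N -> contr_even (Jf m n i j) H = 0.
Proof.
move=> mi mj; rewrite /contr_even big1 // => p _; rewrite big1 // => q _.
by rewrite /Jf mi mj [(i <= m)%N]leqNgt mi /= ev_zero mul0r.
Qed.

Lemma contr_odd_JE i j H : (i <= m)%N -> (j <= m)%N -> contr_odd (Jf m n i j) H = 0.
Proof. by move=> im jm; rewrite /contr_odd big1 // => a _; rewrite /Jf im jm /= ev_zero mul0r. Qed.

Lemma contr_odd_par_JE i j H : (i <= m)%N -> (j <= m)%N -> contr_odd_par (Jf m n i j) H = 0.
Proof.
move=> im jm; rewrite /contr_odd_par big1 // => a _; rewrite /Jf im jm /= ev_zero.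
by rewrite -(scale0r 0) gparZ !scale0r mul0r.
Qed.

Lemma contr_odd_JM i j H : contr_odd (Jmixed m n i j) H = x i.-1 *: gsq * Dy (j - m) H.
Proof.
rewrite /contr_odd /Dy mulr_sumr; apply: eq_bigr => a _.
by rewrite ev_scal ev_mul ev_ev ev_tser -(scalerAl (x i.-1)) mul1r -scalerAl -scalerAr.
Qed.

Lemma contr_odd_par_JM i j H : contr_odd_par (Jmixed m n i j) H = x i.-1 *: gsq * Dy (j - m) H.
Proof.
rewrite -contr_odd_JM; apply: eq_bigr => a _.
rewrite ev_scal ev_mul ev_ev ev_tser -(scalerAl (x i.-1)) mul1r !gparZ gpar_even //.
exact: gser_even.
Qed.

Lemma contr_odd_JO i j H : (m < i)%N -> (m < j)%N -> contr_odd (Jf m n i j) H =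
  gy (i - m).-1 * Dy (j - m) H + gy (j - m).-1 * Dy (i - m) H.
Proof.
move=> mi mj; rewrite /contr_odd /Dy !mulr_sumr -big_split; apply: eq_bigr => a _.
rewrite /Jf mi mj [(i <= m)%N]leqNgt mi /= ev_add !ev_scal mulrDl.
by rewrite -!scalerAl -!scalerAr.
Qed.

Lemma contr_odd_par_JO i j H : (m < i)%N -> (m < j)%N -> contr_odd_par (Jf m n i j) H =
  - (gy (i - m).-1 * Dy (j - m) H + gy (j - m).-1 * Dy (i - m) H).
Proof.
move=> mi mj; rewrite -contr_odd_JO // /contr_odd -sumrN; apply: eq_bigr => a _.
rewrite /Jf mi mj [(i <= m)%N]leqNgt mi /= ev_add !ev_scal gparD !gparZ.
by rewrite !gpar_odd ?scalerN -?opprD ?mulNr //; apply: gy_odd.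
Qed.

Lemma sum_sq : \sum_(1 <= p < m.+1) x p.-1 * x p.-1 = 1.
Proof.
rewrite big_add1 big_mkord -[RHS]xS; apply: eq_bigr => p _ /=.
by rewrite Rmult_1_r.
Qed.

Lemma kdC a b : kd a b = kd b a.
Proof. by rewrite /kd eq_sym. Qed.

Lemma sum_kd q : (1 <= q <= m)%N -> \sum_(1 <= p < m.+1) x p.-1 * kd q p = x q.-1.
Proof.
move=> hq; rewrite (@big_nat_pick _ _ _ q) ?ltnS // => [|k kq]; first by rewrite /kd eqxx mulr1.
by rewrite kdC /kd (negPf kq) mulr0.
Qed.

Lemma sum_lin (A B C D : R) q q' : (1 <= q <= m)%N -> (1 <= q' <= m)%N ->
  \sum_(1 <= p < m.+1) (A * (x p.-1 * x p.-1) + B * (x p.-1 * x p.-1) +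
     (C * (x p.-1 * kd q p) + D * (x p.-1 * kd q' p))) =
  A + B + (C * x q.-1 + D * x q'.-1).
Proof. by move=> hq hq'; rewrite !big_split /= -!mulr_sumr sum_sq !sum_kd // !mulr1. Qed.

(** On the sphere [sum_k x_k L_kl = e_l - x_l x] is the tangential projection of [e_l]; its product
    with the tangent vector [L_pq] is the [l]-th component of [L_pq]. *)
Lemma sum_rho_r p q l : (1 <= p <= m)%N -> (1 <= q <= m)%N ->
  \sum_(1 <= k < m.+1) x k.-1 * rho p q k l = x p.-1 * kd q l - x q.-1 * kd p l.
Proof.
move=> hp hq; rewrite (eq_bigr (fun k => (x p.-1 * kd q l) * (x k.-1 * x k.-1) +
   (- (x q.-1 * kd p l)) * (x k.-1 * x k.-1) +
   ((- (x p.-1 * x l.-1)) * (x k.-1 * kd q k) + (x q.-1 * x l.-1) * (x k.-1 * kd p k)))).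
  by rewrite sum_lin //; ringR.
by move=> k _; rewrite /rho; ringR.
Qed.

Lemma sum_rho_l i k l : (1 <= k <= m)%N -> (1 <= l <= m)%N ->
  \sum_(1 <= p < m.+1) x p.-1 * rho p i k l = x k.-1 * kd i l - x l.-1 * kd i k.
Proof.
move=> hk hl; rewrite (kdC i l) (kdC i k) -sum_rho_r //; apply: eq_bigr => p _.
by rewrite /rho !(kdC p) !(kdC i); congr (_ * _); ringR.
Qed.

Lemma sum_scale (r : nat -> R) (u : grass n) :
  \sum_(1 <= p < m.+1) x p.-1 *: (r p *: u) = (\sum_(1 <= p < m.+1) x p.-1 * r p) *: u.
Proof. by rewrite scaler_suml; apply: eq_bigr => p _; rewrite scalerA. Qed.

Lemma Jf_mixed i j : (i <= m)%N -> (m < j)%N -> Jf m n i j = Jmixed m n i j.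
Proof. by move=> im mj; rewrite /Jf im [(j <= m)%N]leqNgt mj ltnNge im. Qed.

Lemma hX_even i : (i <= m)%N -> hX x i = x i.-1 *: gsq.
Proof. by rewrite /proj_coord => ->. Qed.
Lemma hX_odd i : (m < i)%N -> hX x i = gy (i - m).-1.
Proof. by move=> mi; rewrite /proj_coord leqNgt mi. Qed.

Lemma gcov_even j l : (j <= m)%N -> gcov m j l = kd j l.
Proof. by rewrite /gcov => ->. Qed.
Lemma gcov_eo j l : (j <= m)%N -> (m < l)%N -> gcov m j l = 0.
Proof. by move=> jm ml; rewrite gcov_even // /kd ifN //; lia. Qed.
Lemma gcov_oe j l : (m < j)%N -> (l <= m)%N -> gcov m j l = 0.
Proof.
by move=> mj lm; rewrite /gcov leqNgt mj /=; case: ifP => oj; rewrite ifN //; lia.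
Qed.
Lemma gcov_oo j l : (m < j)%N -> (m < l)%N -> gcov m j l = dyUpc (j - m) (l - m).
Proof.
move=> mj ml; rewrite /gcov /dyUpc leqNgt mj /=; case: ifP => oj.
  by rewrite [l == _](_ : _ = (l - m == (j - m).+1)%N) //; lia.
by rewrite [l == _](_ : _ = (l - m == (j - m).-1)%N) //; lia.
Qed.

(** * Comparison of the two metrics according to the parities of the four indices *)

Notation ein i := (1 <= i <= m)%N.
Notation oin i := (m < i <= m + 2 * n)%N.
Notation MS i j k l := (ev x (metS m n (Jf m n i j) (Jf m n k l))).
Notation Rform := (amb_form m n x).

Lemma par_even i : (i <= m)%N -> par m i = false.
Proof. by move=> im; rewrite /par ltnNge im. Qed.

(** A product of two projected even coordinates carries [sq^2 = 1 - theta^2], the factor in front of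
    the round metric. *)
Lemma met_even_even i j k l : ein i -> ein j -> ein k -> ein l -> MS i j k l = Rform i j k l.
Proof.
move=> hi hj hk hl; rewrite ev_metS !contr_even_JE //.
have [/andP[_ ei] /andP[_ ej]] := (hi, hj); have [/andP[_ ek] /andP[_ el]] := (hk, hl).
rewrite contr_odd_JE // addr0 -(gsq2 _ _ _ xS) /amb_form /psign /Lsign !hX_even // !gcov_even // !par_even //=.
rewrite !scalerA !mulrDr -!scalerAl -!scalerAr !scalerDr !scalerA -!scalerDl.
by congr (_ *: _); rewrite /rho; ringR.
Qed.

Lemma met_even_odd i j k l : ein i -> ein j -> oin k -> oin l -> MS i j k l = Rform i j k l.
Proof.
move=> hi hj /andP[ok _] /andP[ol _]; have [/andP[_ ei] /andP[_ ej]] := (hi, hj).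
rewrite ev_metS contr_even_JE // contr_even_JO // contr_odd_JE // addr0 /amb_form !gcov_eo // !mulr0 !scale0r.
by rewrite !addr0 !mulr0 scaler0 addr0.
Qed.

Lemma met_odd_even i j k l : oin i -> oin j -> ein k -> ein l -> MS i j k l = Rform i j k l.
Proof.
move=> /andP[oi _] /andP[oj _] hk hl; have [/andP[_ ek] /andP[_ el]] := (hk, hl).
rewrite ev_metS contr_even_JO // add0r contr_odd_JO //.
have D0 b : Dy b (fun a => contr_odd_par (Jf m n k l) (fun c => ev x (gS n a c))) = 0.
  by rewrite (eq_Dy _ _ (fun _ => 0)) ?Dy0 // => a; rewrite contr_odd_par_JE.
by rewrite !D0 !mulr0 addr0 /amb_form !gcov_oe // !mulr0 !scale0r !addr0 !mulr0 scaler0 addr0.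
Qed.

Lemma gsqC u : gsq * u = u * gsq.
Proof. by apply: gevenC; apply: gser_even. Qed.
Lemma gisqC u : gisq * u = u * gisq.
Proof. by apply: gevenC; apply: gser_even. Qed.
Lemma gKC u : gK * u = u * gK.
Proof. by apply: gevenC; apply: gser_even. Qed.
Lemma gisq_sq : gisq * (gsq * gsq) = gsq.
Proof. by rewrite mulrA gisqC (gsq_isq _ _ _ xS) mul1r. Qed.

(** The [isq] of the mixed field reduces the factor [1 - theta^2] to [sq], the one belonging to the
    single even coordinate left by [sum_rho_r]. *)
Lemma met_even_mixed i j k l : ein i -> ein j -> ein k -> oin l -> MS i j k l = Rform i j k l.
Proof.
move=> hi hj hk /andP[ol _]; have [/andP[_ ei] /andP[_ ej]] := (hi, hj); have /andP[_ ek] := hk.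
rewrite ev_metS contr_even_JE // contr_odd_JE // addr0 Jf_mixed // contr_even_JM // sum_scale sum_rho_r //.
rewrite -(gsq2 _ _ _ xS) -scalerAr -mulrA gisq_sq.
rewrite /amb_form !(gcov_eo _ l) // !mulr0 !scale0r !add0r /psign /Lsign !(par_even i) ?(par_even j) ?(par_even k) //=.
rewrite (hX_even i) // (hX_even j) // (hX_odd l) // !gcov_even //.
rewrite -!scalerAl -!scalerAr !scalerA -scalerDl -scaleNr gsqC; congr (_ *: _); ringR.
Qed.

Lemma met_mixed_even i j k l : ein i -> oin j -> ein k -> ein l -> MS i j k l = Rform i j k l.
Proof.
move=> hi /andP[oj _] hk hl; have [/andP[_ ek] /andP[_ el]] := (hk, hl); have /andP[_ ei] := hi.
rewrite ev_metS Jf_mixed // contr_even_JM // contr_odd_JM.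
rewrite (eq_bigr (fun p => x p.-1 *: (rho p i k l *: (1 - gth)))); last by move=> p _; rewrite contr_even_JE.
rewrite (eq_Dy _ _ (fun _ => 0)); last by move=> a; rewrite contr_odd_par_JE.
rewrite Dy0 mulr0 addr0.
rewrite sum_scale sum_rho_l // -(gsq2 _ _ _ xS) -scalerAr -mulrA gisq_sq.
rewrite /amb_form !(gcov_oe j) // !mulr0 !scale0r !addr0 !mulr0 add0r /psign /Lsign !(par_even i) ?(par_even k) //=.
rewrite (hX_even k) // (hX_even l) // (hX_odd j) // !gcov_even //.
rewrite -?scalerAl -?scalerAr !scalerA -scalerDl -scalerAr scalerA -scaleNr.
congr (_ *: _); ringR.
Qed.

(** The factor [1 - theta^2] cancels the denominator of the correction term. *)
Lemma gsq2_gS_up j l : gsq * (gsq * gS_up j l) = dyUpc j l *: (gsq * gsq) + gy j.-1 * gy l.-1.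
Proof.
rewrite mulrA /gS_up mulrDr -scalerAr mulr1; congr (_ + _).
by rewrite -gKC mulrA (gsq2 _ _ _ xS) gK_inv mul1r.
Qed.

(** The corrections [y_k y_j y_l] and [y_l y_j y_k] are opposite, since reversing three odd factors
    is an odd permutation. *)
Lemma gy_gS_up_r j k l : gy k.-1 * gS_up j l + gy l.-1 * gS_up j k =
  dyUpc j l *: gy k.-1 + dyUpc j k *: gy l.-1.
Proof.
have an a b : gy a * gy b = - (gy b * gy a) by apply: godd_anti; apply: gy_odd.
rewrite /gS_up !mulrDr -!scalerAr !mulr1 addrACA -[RHS]addr0; congr (_ + _).
have e : gy k.-1 * gy j.-1 * gy l.-1 = - (gy l.-1 * gy j.-1 * gy k.-1).
  rewrite (an k.-1 j.-1) mulNr -(mulrA (gy j.-1)) (an k.-1 l.-1) mulrN opprK mulrA.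
  by rewrite (an j.-1 l.-1) mulNr.
by rewrite !mulrA -mulrDl e addNr mul0r.
Qed.

Lemma gy_gS_up_l i j l : gy i.-1 * gS_up j l + gy j.-1 * gS_up i l =
  dyUpc j l *: gy i.-1 + dyUpc i l *: gy j.-1.
Proof.
have an a b : gy a * gy b = - (gy b * gy a) by apply: godd_anti; apply: gy_odd.
rewrite /gS_up !mulrDr -!scalerAr !mulr1 addrACA -[RHS]addr0; congr (_ + _).
by rewrite !mulrA -!mulrDl (an i.-1) addNr !mul0r.
Qed.

(** The even half contributes [(delta_ik - x_i x_k) y_j y_l] and the odd half the correction
    [x_i x_k y_j y_l]; beside the flat odd term only [delta_ik y_j y_l] survives. *)
Lemma met_mixed_mixed i j k l : ein i -> oin j -> ein k -> oin l -> MS i j k l = Rform i j k l.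
Proof.
move=> hi /andP[oj jm] hk /andP[ol lm]; have [/andP[_ ei] /andP[_ ek]] := (hi, hk).
have bj : (1 <= j - m <= 2 * n)%N by lia.
have bl : (1 <= l - m <= 2 * n)%N by lia.
rewrite ev_metS !Jf_mixed // contr_even_JM // contr_odd_JM.
rewrite (eq_Dy _ _ _ (fun a => contr_odd_par_JM k l _)) Dy_mull Dy_gS //.
rewrite (eq_big_nat _ _ (F2 := fun p => x p.-1 *: ((x p.-1 * kd i k - x i.-1 * kd p k) *:
    (- (gy (l - m).-1 * gsq))))); last first.
  move=> p hp; rewrite contr_even_JM // sum_scale sum_rho_r // -(gsq2 _ _ _ xS) -scalerAr -mulrA gisq_sq.
  by congr (_ *: _); rewrite scalerN.
rewrite sum_scale.
(* This is the inner product of the tangential projections of [e_i] and [e_k]. *)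
have -> : \sum_(1 <= p < m.+1) x p.-1 * (x p.-1 * kd i k - x i.-1 * kd p k) = kd i k - x i.-1 * x k.-1.
  rewrite (eq_bigr (fun p => kd i k * (x p.-1 * x p.-1) + 0 * (x p.-1 * x p.-1) +
    (- x i.-1 * (x p.-1 * kd k p) + 0 * (x p.-1 * kd k p)))) ?sum_lin //; first by ringR.
  by move=> p _; rewrite (kdC p); ringR.
rewrite /amb_form (gcov_oe j k) // (gcov_eo i l) // !mulr0 !scale0r addr0 add0r.
rewrite /psign /Lsign !(par_even i) ?(par_even k) //= (hX_even i) // (hX_even k) // (hX_odd j) // (hX_odd l) // (gcov_even i) // (gcov_oo j) //.
set t := dyUpc _ _; set A := gy (j - m).-1; set B := gy (l - m).-1.
have -> : A * gisq * ((kd i k - x i.-1 * x k.-1) *: - (B * gsq)) =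
    - ((kd i k - x i.-1 * x k.-1) *: (A * B)).
  rewrite -scalerAr mulrN scalerN; congr (- (_ *: _)).
  by rewrite -mulrA -gsqC (mulrA gisq) (gisqC gsq) (gsq_isq _ _ _ xS) mul1r.
rewrite opprK -!scalerAl -!scalerAr gsq2_gS_up -/t -/A -/B andbF !scalerDr !scalerA.
rewrite addrCA -scalerDl; congr (_ *: _ + _ *: _); ringR.
Qed.

Lemma met_mixed_odd i j k l : ein i -> oin j -> oin k -> oin l -> MS i j k l = Rform i j k l.
Proof.
move=> hi /andP[oj jm] /andP[ok km] /andP[ol lm]; have /andP[_ ei] := hi.
have bj : (1 <= j - m <= 2 * n)%N by lia.
have bk : (1 <= k - m <= 2 * n)%N by lia.
have bl : (1 <= l - m <= 2 * n)%N by lia.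
rewrite ev_metS Jf_mixed // contr_even_JM // contr_odd_JM big1 => [|p _]; last by rewrite contr_even_JO // scaler0.
rewrite mulr0 oppr0 add0r (eq_Dy _ _ _ (fun a => contr_odd_par_JO k l _ ok ol)) DyN DyD !Dy_mull !Dy_gS //.
rewrite gy_gS_up_r /amb_form !(gcov_eo i) // !mulr0 !scale0r !addr0 mulr0 scaler0 addr0.
rewrite /psign /Lsign /par oj ok ol /= (hX_even i) // (hX_odd k) // (hX_odd l) // !gcov_oo //.
congr (_ * _); rewrite opprD -!scaleNr; congr (_ *: _ + _ *: _); ringR.
Qed.

Lemma met_odd_mixed i j k l : oin i -> oin j -> ein k -> oin l -> MS i j k l = Rform i j k l.
Proof.
move=> /andP[oi im] /andP[oj jm] hk /andP[ol lm]; have /andP[_ ek] := hk.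
have bi : (1 <= i - m <= 2 * n)%N by lia.
have bj : (1 <= j - m <= 2 * n)%N by lia.
have bl : (1 <= l - m <= 2 * n)%N by lia.
rewrite ev_metS contr_even_JO // add0r contr_odd_JO // (Jf_mixed k) //.
rewrite !(eq_Dy _ _ _ (fun a => contr_odd_par_JM k l _)) !Dy_mull !Dy_gS //.
rewrite -!(scalerAl (x k.-1)) -!(scalerAr (x k.-1)) -scalerDr !mulrA -!gsqC -!mulrA -mulrDr gy_gS_up_l.
rewrite /amb_form (gcov_oe j k) // (gcov_oe i k) // !mulr0 !scale0r !addr0.
rewrite /psign /Lsign /par oi oj ?ol [(m < k)%N]ltnNge ek /= (hX_even k) // (hX_odd i) // (hX_odd j) // !gcov_oo //.
rewrite mulrDr scalerDr -!scalerAr !scalerA !gsqC; congr (_ *: _ + _ *: _); ringR.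
Qed.

Lemma met_odd_odd i j k l : oin i -> oin j -> oin k -> oin l -> MS i j k l = Rform i j k l.
Proof.
move=> /andP[oi im] /andP[oj jm] /andP[ok km] /andP[ol lm].
have bi : (1 <= i - m <= 2 * n)%N by lia.
have bj : (1 <= j - m <= 2 * n)%N by lia.
have bk : (1 <= k - m <= 2 * n)%N by lia.
have bl : (1 <= l - m <= 2 * n)%N by lia.
rewrite ev_metS contr_even_JO // add0r contr_odd_JO //.
rewrite !(eq_Dy _ _ _ (fun a => contr_odd_par_JO k l _ ok ol)) !DyN !DyD !Dy_mull !Dy_gS // !gy_gS_up_r.
rewrite /amb_form /psign /Lsign /par oi oj ok ol /= !hX_odd // !gcov_oo // scale1r.
by rewrite !opprD -!scaleNr; congr (_ * (_ *: _ + _ *: _) + _ * (_ *: _ + _ *: _)); ringR.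
Qed.

Lemma metS_oppl V W : ev x (metS m n (vfs_opp V) W) = - ev x (metS m n V W).
Proof.
rewrite !ev_metS opprD; congr (_ + _); rewrite -sumrN; apply: eq_bigr => p _.
  by rewrite -sumrN; apply: eq_bigr => q _; rewrite ev_opp mulNr.
by rewrite ev_opp mulNr.
Qed.

Lemma metS_oppr V W : ev x (metS m n V (vfs_opp W)) = - ev x (metS m n V W).
Proof.
have c1N H : contr_even (vfs_opp W) H = - contr_even W H.
  rewrite -sumrN; apply: eq_bigr => p _.
  by rewrite -sumrN; apply: eq_bigr => q _; rewrite ev_opp mulNr.
have c2N H : contr_odd_par (vfs_opp W) H = - contr_odd_par W H.
  by rewrite -sumrN; apply: eq_bigr => p _; rewrite ev_opp gparN mulNr.
rewrite !ev_metS opprD; congr (_ + _); rewrite -sumrN; apply: eq_bigr => p _.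
  by rewrite -sumrN; apply: eq_bigr => q _; rewrite c1N mulrN.
by rewrite c2N mulrN.
Qed.

Lemma Jf_flip i j : (i <= m)%N -> (m < j)%N -> Jf m n j i = vfs_opp (Jf m n i j).
Proof.
by move=> im mj; rewrite (Jf_mixed i j) // /Jf [(j <= m)%N]leqNgt mj im /= ltnNge im.
Qed.

Lemma Lsign_mixed i j : (i <= m)%N -> Lsign m i j = -1 /\ Lsign m j i = -1.
Proof. by move=> im; rewrite /Lsign (par_even i) // andbF. Qed.

Lemma Rform_flipl i j k l : (i <= m)%N -> Rform j i k l = - Rform i j k l.
Proof.
move=> im; rewrite /amb_form; have [-> ->] := Lsign_mixed i j im.
by rewrite !scaleN1r opprB.
Qed.

Lemma Rform_flipr i j k l : (k <= m)%N -> Rform i j l k = - Rform i j k l.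
Proof.
move=> km; rewrite /amb_form; have [-> ->] := Lsign_mixed k l km.
rewrite opprD -scalerN -!mulrN !opprD; congr (_ * _ + _ *: (_ * _)).
  by rewrite addrC !mulN1r !scaleNr opprK.
by rewrite addrC !mulN1r !scaleNr opprK.
Qed.

(** Excludes only an odd index followed by an even one. Antisymmetry recovers these pairs, so nine
    parity cases replace sixteen. *)
Definition ordered i j := (i <= m)%N || (m < j)%N.

Lemma metric_ordered i j k l : (1 <= i <= m + 2 * n)%N -> (1 <= j <= m + 2 * n)%N ->
  (1 <= k <= m + 2 * n)%N -> (1 <= l <= m + 2 * n)%N ->
  ordered i j -> ordered k l -> MS i j k l = Rform i j k l.
Proof.
move=> hi hj hk hl; rewrite /ordered.
have [ei|oi] := leqP i m; have [ej|oj] := leqP j m; have [ek|ok] := leqP k m; have [el|ol] := leqP l m => // _ _;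
  [ apply: met_even_even | apply: met_even_mixed | apply: met_even_odd
  | apply: met_mixed_even | apply: met_mixed_mixed | apply: met_mixed_odd
  | apply: met_odd_even | apply: met_odd_mixed | apply: met_odd_odd ]; lia.
Qed.

Lemma metric_onS i j k l : (1 <= i <= m + 2 * n)%N -> (1 <= j <= m + 2 * n)%N ->
  (1 <= k <= m + 2 * n)%N -> (1 <= l <= m + 2 * n)%N -> MS i j k l = Rform i j k l.
Proof.
move=> hi hj hk hl.
have half i' j' : (1 <= i' <= m + 2 * n)%N -> (1 <= j' <= m + 2 * n)%N ->
    ordered i' j' -> MS i' j' k l = Rform i' j' k l.
  move=> hi' hj' oij; have [okl|nkl] := boolP (ordered k l); first exact: metric_ordered.
  have [ok el] : (m < k)%N /\ (l <= m)%N by move: nkl; rewrite /ordered; lia.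
  by rewrite (Jf_flip l k) // metS_oppr metric_ordered // ?(Rform_flipr i' j' l k) // /ordered el.
have [/half -> //|nij] := boolP (ordered i j).
have [oi ej] : (m < i)%N /\ (j <= m)%N by move: nij; rewrite /ordered; lia.
by rewrite (Jf_flip j i) // metS_oppl half // ?(Rform_flipl j i k l) // /ordered ej.
Qed.

End SphereMetric.

Local Open Scope R_scope.

Theorem theorem5p5 (m n : nat) : (1 <= m)%N ->
  (forall F : SF n, (forall S, Cinf m (F S)) ->
     forall i j : nat, (1 <= i <= m + 2 * n)%N -> (1 <= j <= m + 2 * n)%N ->
     forall (S : Mon n) (x : Pt), onS m x ->
       actS m n (Jf m n i j) (piS m n F) S x = piS m n (actR m n (Lf m n i j) F) S x)
  /\
  (forall i j k l : nat,
     (1 <= i <= m + 2 * n)%N -> (1 <= j <= m + 2 * n)%N ->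
     (1 <= k <= m + 2 * n)%N -> (1 <= l <= m + 2 * n)%N ->
     forall (S : Mon n) (x : Pt), onS m x ->
       metS m n (Jf m n i j) (Jf m n k l) S x
       = piS m n (metR m n (Lf m n i j) (Lf m n k l)) S x).
Proof.
move=> _; split=> [F sF i j hi hj S x xS | i j k l hi hj hk hl S x xS].
  (* Both claims concern one coefficient at one point, so they are read off from identities in
     [grass]. *)
  rewrite -[RHS]/(ev n x (phi m n (actR m n (Lf m n i j) F)) S) ev_phi.
  by rewrite -intertwine // => T; apply: Cinf_smk.
rewrite -[RHS]/(ev n x (phi m n (metR m n (Lf m n i j) (Lf m n k l))) S) ev_phi pullback_metR //.
by rewrite -metric_onS.
Qed.
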